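(* There is a deterministic algorithm in the synchronous single-port message-passing model with crash failures that, for all $n$ and $t$ with $t<\frac n5$, solves binary consensus in $\mathcal{O}(t+\log n)$ rounds with $\mathcal{O}(n+t\log n)$ bits sent in messages in total.
   Context: Model: $n$ nodes with distinct names in $\{1,\dots,n\}$; $n$ and an upper bound $t$ on the number of crashes are known to all nodes. Computation proceeds in synchronous rounds starting simultaneously. Single-port: in each round a node may send a message to at most one other node and receive a message from at most one other node (a node gets no signal that messages are waiting at its ports). An adversary may crash up to $t$ nodes at times of its choosing; a crashed node performs no further activity. Binary consensus: each node has an input bit and must irrevocably decide so that each decided value is the input of some node, no two nodes decide differently, and every non-crashed node eventually decides and halts. Running time is the number of rounds until all non-faulty nodes have halted. *)

(* Defs.v *)
From mathcomp Require Import all_boot.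

Set Implicit Arguments.
Unset Strict Implicit.
Unset Printing Implicit Defensive.

(* A message is a nonempty bit string (first bit, remaining bits): every message
   costs at least one bit, so its mere presence is never free information. *)
Definition message : Type := bool * seq bool.

Definition message_bits (m : message) : nat := (size m.2).+1.

(* A deterministic single-port algorithm for the nodes 'I_n. In one round, a
   node chooses from its current state at most one message to send and at most
   one port (identified with the node at its other end) to read from; [step]
   gets the message read, or None if no port was read or the port was empty.
   A node may decide before it halts. *)
Record protocol (n : nat) := Protocol {
  state : Type;
  init : 'I_n -> bool -> state;
  send : 'I_n -> state -> option ('I_n * message);
  poll : 'I_n -> state -> option 'I_n;
  step : 'I_n -> state -> option message -> state;
  decision : state -> option bool;
  halted : state -> bool;
  send_other : forall v s w m, send v s = Some (w, m) -> w != v;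
  poll_other : forall v s w, poll v s = Some w -> w != v
}.

(* [f v = Some (k, b)]: node v crashes in round k (rounds are numbered from 0),
   after sending its message of round k if b, before sending it otherwise; in
   either case it neither receives nor changes state in round k or later.
   As algorithms are deterministic, quantifying over all schedules accounts for
   adaptive adversaries. *)
Definition crash_schedule (n : nat) : Type := 'I_n -> option (nat * bool).

Definition crash_bounded n (f : crash_schedule n) (t : nat) : Prop :=
  #|[set v | f v != None]| <= t.

Definition can_send n (f : crash_schedule n) (r : nat) (v : 'I_n) : bool :=
  if f v is Some (k, b) then (r < k) || ((r == k) && b) else true.

Definition completes n (f : crash_schedule n) (r : nat) (v : 'I_n) : bool :=
  if f v is Some (k, _) then r < k else true.

(* v has not crashed in any of the rounds 0, ..., T - 1 *)
Definition alive n (f : crash_schedule n) (T : nat) (v : 'I_n) : bool :=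
  if f v is Some (k, _) then T <= k else true.

(* [port c v w] is the FIFO queue of the messages from w waiting at v. *)
Record config n (P : protocol n) := Config {
  local : 'I_n -> state P;
  port : 'I_n -> 'I_n -> seq message
}.

Definition outgoing n (P : protocol n) (f : crash_schedule n) (r : nat)
    (c : config P) (v : 'I_n) : option ('I_n * message) :=
  if can_send f r v && ~~ halted (local c v) then send v (local c v) else None.

Definition filled_port n (P : protocol n) (f : crash_schedule n) (r : nat)
    (c : config P) (v w : 'I_n) : seq message :=
  if outgoing f r c w is Some (u, m) then
    if u == v then rcons (port c v w) m else port c v w
  else port c v w.

Definition polled n (P : protocol n) (f : crash_schedule n) (r : nat)
    (c : config P) (v : 'I_n) : option 'I_n :=
  if completes f r v && ~~ halted (local c v) then poll v (local c v) else None.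

Definition received n (P : protocol n) (f : crash_schedule n) (r : nat)
    (c : config P) (v : 'I_n) : option message :=
  if polled f r c v is Some w then ohead (filled_port f r c v w) else None.

(* A message sent in a round can be read from its port in the same round or in
   any later one. *)
Definition next_config n (P : protocol n) (f : crash_schedule n) (r : nat)
    (c : config P) : config P :=
  Config
    (fun v => if completes f r v && ~~ halted (local c v)
              then step v (local c v) (received f r c v) else local c v)
    (fun v w => if polled f r c v == Some w
                then behead (filled_port f r c v w) else filled_port f r c v w).

(* The configuration after the rounds 0, ..., r - 1. *)
Fixpoint execution n (P : protocol n) (x : 'I_n -> bool) (f : crash_schedule n)
    (r : nat) : config P :=
  if r is r'.+1 then next_config f r' (execution P x f r')
  else Config (fun v => init P v (x v)) (fun _ _ => [::]).

Definition decides n (P : protocol n) x (f : crash_schedule n)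
    (r : nat) (v : 'I_n) (b : bool) : Prop :=
  decision (local (execution P x f r) v) = Some b.

Definition all_halted n (P : protocol n) x (f : crash_schedule n)
    (T : nat) : Prop :=
  forall v, alive f T v -> halted (local (execution P x f T) v).

(* Validity, agreement and irrevocability also constrain the nodes that crash
   after deciding. *)
Definition solves_consensus n (P : protocol n) (t : nat) : Prop :=
  forall (x : 'I_n -> bool) (f : crash_schedule n), crash_bounded f t ->
  [/\ forall r v b, decides P x f r v b -> exists w, x w = b,
      forall r r' v w b b',
        decides P x f r v b -> decides P x f r' w b' -> b = b',
      forall r r' v b, r <= r' -> decides P x f r v b -> decides P x f r' v b
    & exists T, all_halted P x f T /\
        forall v, alive f T v -> exists b, decides P x f T v b].

Definition runs_within n (P : protocol n) (t B : nat) : Prop :=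
  forall (x : 'I_n -> bool) (f : crash_schedule n), crash_bounded f t ->
  exists2 T, T <= B & all_halted P x f T.

Definition bits_sent n (P : protocol n) x (f : crash_schedule n)
    (R : nat) : nat :=
  \sum_(r < R) \sum_(v < n)
    if outgoing f r (execution P x f r) v is Some (_, m)
    then message_bits m else 0.

Definition sends_within n (P : protocol n) (t B : nat) : Prop :=
  forall (x : 'I_n -> bool) (f : crash_schedule n), crash_bounded f t ->
  forall R, bits_sent P x f R <= B.

(* Main.v *)
Require Import Defs.
From mathcomp Require Import all_boot.
From mathcomp Require Import fingroup perm zify.
From Stdlib Require Import IndefiniteDescription.

Set Implicit Arguments.
Unset Strict Implicit.
Unset Printing Implicit Defensive.

(** In every round, the nodes communicate along a fixed permutation, so nobody
    ever waits at the wrong port.  The permutations form expanders, which exist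
    by a union bound.

    The first [m = 5 * t + 1] nodes flood the value 1 along a constant-degree
    expander.  A node forwards only once, immediately after it was reached, so
    after O(m) rounds the flooding has stopped and the two ends of every edge
    agree, unless one of them has crashed.  These nodes then probe their
    neighbours O(log m) times and drop out when too few of them respond.  The
    nodes responding to a survivor, those responding to them, and so on, all hold
    its value, and their number doubles until it is a constant fraction of [m];
    two sets of that size are joined by an edge, so all survivors agree.  On the
    other hand, the expansion leaves more than half of the [m] nodes in a set
    that no [t] crashes can make drop out.

    The survivors know the value.  Copying it along the residue classes modulo
    [m] informs a third of all nodes, and then uninformed nodes send inquiries:
    each O(1) of them halve the number of uninformed nodes until it is O(t), and
    [2 ^ i] further inquiries per node reduce it to [t / 2 ^ i]. *)

(** * Crash schedules *)

Section Crashes.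
Variables (n : nat) (f : crash_schedule n).

Lemma completesE r v : completes f r v = alive f r.+1 v.
Proof. by rewrite /completes /alive; case: (f v) => [[k b]|]. Qed.

Lemma alive_le r r' v : r <= r' -> alive f r' v -> alive f r v.
Proof. by rewrite /alive; case: (f v) => [[k b]|] //; apply: leq_trans. Qed.

Lemma can_send_alive r v : can_send f r v -> alive f r v.
Proof. rewrite /can_send /alive; case: (f v) => [[k b]|] //; lia. Qed.

Lemma alive_can_send r v : alive f r.+1 v -> can_send f r v.
Proof. by rewrite /can_send /alive; case: (f v) => [[k b]|] // ->. Qed.

Lemma correct_alive r v : f v = None -> alive f r v.
Proof. by rewrite /alive => ->. Qed.

End Crashes.

(** * Programs *)

Section Programs.
Variables (n : nat) (S : Type).

(* In a round, every node [v] may send one bit to [rperm v] and polls the node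
   that may send to it, so no message ever waits at the port of a node that has
   not crashed.  A fixed point of [rperm] hears itself at no cost. *)
Record round := Round {
  rperm : {perm 'I_n};
  rout : 'I_n -> S -> option bool;
  rupd : 'I_n -> S -> option bool -> S
}.

Definition heard (f : crash_schedule n) r rd (c : 'I_n -> S) v : option bool :=
  let u := (rperm rd)^-1%g v in if can_send f r u then rout rd u (c u) else None.

Definition round_step (f : crash_schedule n) r rd (c : 'I_n -> S) v : S :=
  if completes f r v then rupd rd v (c v) (heard f r rd c v) else c v.

Fixpoint run (f : crash_schedule n) r p (c : 'I_n -> S) : 'I_n -> S :=
  if p is rd :: p' then run f r.+1 p' (round_step f r rd c) else c.

Definition talkers (f : crash_schedule n) r rd (c : 'I_n -> S) : {set 'I_n} :=
  [set v | can_send f r v && (rout rd v (c v) != None)].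

Fixpoint traffic (f : crash_schedule n) r p (c : 'I_n -> S) : nat :=
  if p is rd :: p' then #|talkers f r rd c| + traffic f r.+1 p' (round_step f r rd c)
  else 0.

Lemma run_cat f r p q c : run f r (p ++ q) c = run f (r + size p) q (run f r p c).
Proof. by elim: p r c => [|rd p IH] r c /=; rewrite ?addn0 // IH addnS. Qed.

Lemma run_rcons f r p rd c :
  run f r (rcons p rd) c = round_step f (r + size p) rd (run f r p c).
Proof. by rewrite -cats1 run_cat. Qed.

Lemma traffic_cat f r p q c :
  traffic f r (p ++ q) c = traffic f r p c + traffic f (r + size p) q (run f r p c).
Proof. by elim: p r c => [|rd p IH] r c /=; rewrite ?addn0 // IH addnS addnA. Qed.

Lemma traffic_rcons f r p rd c :
  traffic f r (rcons p rd) c =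
  traffic f r p c + #|talkers f (r + size p) rd (run f r p c)|.
Proof. by rewrite -cats1 traffic_cat /= addn0. Qed.

Lemma run_mkseqS f r F k c :
  run f r (mkseq F k.+1) c = round_step f (r + k) (F k) (run f r (mkseq F k) c).
Proof. by rewrite mkseqS run_rcons size_mkseq. Qed.

Lemma traffic_mkseqS f r F k c :
  traffic f r (mkseq F k.+1) c =
  traffic f r (mkseq F k) c + #|talkers f (r + k) (F k) (run f r (mkseq F k) c)|.
Proof. by rewrite mkseqS traffic_rcons size_mkseq. Qed.

Lemma heard_Some f r rd c v b : heard f r rd c v = Some b ->
  let u := (rperm rd)^-1%g v in can_send f r u /\ rout rd u (c u) = Some b.
Proof. by rewrite /heard; case: ifP. Qed.

(** * From programs to protocols *)

Section Protocol.
Variables (p : seq round) (ini : 'I_n -> bool -> S) (dec : S -> bool).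

Definition prog_send v (s : nat * S) : option ('I_n * message) :=
  if onth p s.1 is Some rd then
    if rperm rd v == v then None
    else omap (fun b => (rperm rd v, (b, [::]))) (rout rd v s.2)
  else None.

Definition prog_poll v (s : nat * S) : option 'I_n :=
  if onth p s.1 is Some rd then
    if (rperm rd)^-1%g v == v then None else Some ((rperm rd)^-1%g v)
  else None.

Definition prog_step v (s : nat * S) (m : option message) : nat * S :=
  (s.1.+1,
   if onth p s.1 is Some rd then
     rupd rd v s.2 (if (rperm rd)^-1%g v == v then rout rd v s.2 else omap fst m)
   else s.2).

Lemma prog_send_other v s w m : prog_send v s = Some (w, m) -> w != v.
Proof.
rewrite /prog_send; case: onth => // rd; case: eqP => //= /eqP ne.
by case: rout => //= b [<- _].
Qed.

Lemma prog_poll_other v s w : prog_poll v s = Some w -> w != v.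
Proof.
rewrite /prog_poll; case: onth => // rd; case: eqP => //= /eqP ne.
by case=> <-.
Qed.

Definition program_protocol : protocol n :=
  @Protocol n (nat * S)%type (fun v b => (0, ini v b)) prog_send prog_poll prog_step
    (fun s => if size p <= s.1 then Some (dec s.2) else None)
    (fun s => size p <= s.1) prog_send_other prog_poll_other.

Local Notation P := program_protocol.

(** The number of completed rounds: the clock of a node stops when it crashes. *)
Definition clock (f : crash_schedule n) r v : nat :=
  if f v is Some (k, _) then minn r k else r.

Lemma clock_alive f r v : alive f r v -> clock f r v = r.
Proof. rewrite /alive /clock; case: (f v) => [[k b]|] //; lia. Qed.

Lemma clockS f r v : clock f r.+1 v = if completes f r v then r.+1 else clock f r v.
Proof. rewrite /completes /clock; case: (f v) => [[k b]|] //; case: ltnP; lia. Qed.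

Lemma clock_le f r v : clock f r v <= r.
Proof. rewrite /clock; case: (f v) => [[k b]|] //; lia. Qed.

Variables (x : 'I_n -> bool) (f : crash_schedule n).

Local Notation c0 := (fun v => ini v (x v)).

Lemma onth_take rd r : onth p r = Some rd -> take r.+1 p = rcons (take r p) rd.
Proof.
move=> h; have hr : r < size p by rewrite -onthTE h.
by rewrite (take_nth rd hr); congr rcons; apply: Some_inj; rewrite -h onthE (nth_map rd).
Qed.

(** A node polls exactly the node that [rperm] lets send to it, so whatever arrives at a live node
    is read in the same round and its ports are empty between rounds. The ports of crashed nodes may
    fill up, hence the restriction to [alive]. *)
Lemma execution_program r : r <= size p ->
  (forall v, local (execution P x f r) v = (clock f r v, run f 0 (take r p) c0 v)) /\
  (forall v w, alive f r v -> port (execution P x f r) v w = [::]).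
Proof.
elim: r => [_|r IH hr].
  split=> // v; rewrite take0 /= /clock.
  by case: (f v) => [[k b]|] //; rewrite min0n.
have {IH} [IHl IHp] := IH (ltnW hr).
have [rd hrd] : exists rd, onth p r = Some rd.
  by move: hr; rewrite -onthTE; case: onth => // rd _; exists rd.
have szr : size (take r p) = r by rewrite size_takel // ltnW.
have out w : outgoing f r (execution P x f r) w =
  if can_send f r w && (rperm rd w != w) then
   omap (fun b => (rperm rd w, (b, [::]))) (rout rd w (run f 0 (take r p) c0 w)) else None.
  rewrite /outgoing IHl /=; case hc: (can_send f r w) => //=.
  by rewrite (clock_alive (can_send_alive hc)) leqNgt hr /= /prog_send /= hrd; case: eqP.
have pol v : alive f r.+1 v -> polled f r (execution P x f r) v =
   if (rperm rd)^-1%g v == v then None else Some ((rperm rd)^-1%g v).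
  move=> av; rewrite /polled completesE av IHl /= clock_alive ?(alive_le _ av) //.
  by rewrite leqNgt hr /= /prog_poll /= hrd.
have fil v w : alive f r.+1 v -> filled_port f r (execution P x f r) v w =
    if w == (rperm rd)^-1%g v then
      if (can_send f r w) && (w != v) then
        (if rout rd w (run f 0 (take r p) c0 w) is Some b then [:: (b, [::])] else [::])
      else [::]
    else [::].
  move=> av; rewrite /filled_port out IHp ?(alive_le _ av) //.
  have -> : (w == (rperm rd)^-1%g v) = (rperm rd w == v).
    by apply/eqP/eqP => [->|<-]; rewrite ?permKV ?permK.
  case: (can_send f r w) => /=; last by case: ifP.
  case: (rperm rd w =P v) => [e|ne]; last first.
    by case: (_ != _) => //=; case: rout => //= b; case: eqP ne.
  by rewrite e (eq_sym v w); case: (w == v) => //=; case: rout => //= b; rewrite eqxx.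
split=> [v|v w av].
  rewrite /= (onth_take hrd) run_rcons add0n szr clockS /round_step IHl.
  rewrite completesE; case av: (alive f r.+1 v) => //=.
  rewrite clock_alive ?(alive_le _ av) // leqNgt hr /= /prog_step /= hrd; congr (_, rupd _ _ _ _).
  rewrite /received pol // /heard; case: eqP => [->|/eqP ne].
    by rewrite alive_can_send.
  rewrite fil // eqxx ne andbT; case: can_send => //=.
  by case: rout.
rewrite /= pol // fil //; case: ((rperm rd)^-1%g v =P v) => [e|ne] /=.
  by case: (w =P _) => // ->; rewrite e eqxx andbF.
case: (Some _ =P Some w) => [[->]|ne']; first by rewrite eqxx; case: ifP => //; case: rout.
by case: (w =P _) => // e; case: ne'; rewrite e.
Qed.

Lemma execution_finished r : size p <= r ->
  forall v, local (execution P x f r) v = local (execution P x f (size p)) v.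
Proof.
have [hl _] := execution_program (leqnn (size p)).
elim: r => [|r IH]; first by rewrite leqn0 => /eqP ->.
rewrite leq_eqVlt => /orP[/eqP <- //|hr] v; rewrite ltnS in hr.
rewrite /= IH // hl completesE; case av: (alive f r.+1 v) => //=.
by rewrite clock_alive ?leqnn // (alive_le _ av) // ltnW.
Qed.

Lemma traffic_take r : traffic f 0 (take r p) c0 <= traffic f 0 p c0.
Proof. by rewrite -{2}(cat_take_drop r p) traffic_cat leq_addr. Qed.

(** Every message is a single bit, so counting talkers counts bits; talkers at fixed points of
    [rperm] are counted although they send nothing. *)
Lemma bits_sent_program R : bits_sent P x f R <= traffic f 0 p c0.
Proof.
apply: leq_trans (traffic_take R); rewrite /bits_sent.
elim: R => [|r IH]; first by rewrite big_ord0.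
rewrite big_ord_recr /=; have [hr|hr] := ltnP r (size p); last first.
  have -> : take r.+1 p = take r p by rewrite !take_oversize // ltnW.
  rewrite [X in _ + X]big1 ?addn0 // => v _.
  have [hl _] := execution_program (leqnn (size p)).
  rewrite /outgoing; case hc: (can_send f r v) => //=.
  rewrite execution_finished // hl /= clock_alive ?leqnn //.
  exact: alive_le hr (can_send_alive hc).
have [rd hrd] : exists rd, onth p r = Some rd.
  by move: hr; rewrite -onthTE; case: onth => // rd _; exists rd.
have szr : size (take r p) = r by rewrite size_takel // ltnW.
rewrite (onth_take hrd) traffic_rcons szr add0n leq_add // -sum1_card.
rewrite [X in _ <= X]big_mkcond /=; apply: leq_sum => v _.
have [hl _] := execution_program (ltnW hr).
rewrite inE /outgoing hl /=; case hc: (can_send f r v) => //=.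
rewrite (clock_alive (can_send_alive hc)) -ltnNge hr /= /prog_send /= hrd.
by case: eqP => // _; case: rout.
Qed.

(** Since a decision requires the clock to reach [size p], a node that crashes earlier never
    decides, and validity and agreement concern only the nodes alive at the end of the program. *)
Lemma decides_program r v b : decides P x f r v b ->
  [/\ size p <= r, alive f (size p) v & dec (run f 0 p c0 v) = b].
Proof.
rewrite /decides; have [hr|hr] := ltnP r (size p).
  have [-> _] := execution_program (ltnW hr).
  by rewrite /= leqNgt (leq_ltn_trans (clock_le _ _ _) hr).
rewrite execution_finished //.
have [-> _] := execution_program (leqnn (size p)).
rewrite take_size /=; case: ifP => // hc [<-]; split=> //.
move: hc; rewrite /alive /clock; case: (f v) => [[k b']|] //; lia.
Qed.

Lemma decides_at_end v : alive f (size p) v ->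
  decides P x f (size p) v (dec (run f 0 p c0 v)).
Proof.
move=> av; rewrite /decides; have [-> _] := execution_program (leqnn (size p)).
by rewrite /= clock_alive // leqnn take_size.
Qed.

Lemma all_halted_program : all_halted P x f (size p).
Proof.
move=> v av; have [-> _] := execution_program (leqnn (size p)).
by rewrite /= clock_alive.
Qed.

End Protocol.

Lemma program_correct p ini dec t B :
  (forall x f, crash_bounded f t ->
    traffic f 0 p (fun v => ini v (x v)) <= B /\
    exists b, (exists w, x w = b) /\
      forall v, alive f (size p) v -> dec (run f 0 p (fun v => ini v (x v)) v) = b) ->
  [/\ solves_consensus (program_protocol p ini dec) t,
      runs_within (program_protocol p ini dec) t (size p)
    & sends_within (program_protocol p ini dec) t B].
Proof.
move=> H; split=> [x f hf|x f hf|x f hf R].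
- have [_ [b [[w hw] hb]]] := H x f hf; split.
  + by move=> r v b' /decides_program[_ av <-]; exists w; rewrite hb.
  + move=> r r' v v' b1 b2 /decides_program[_ a1 <-] /decides_program[_ a2 <-].
    by rewrite !hb.
  + move=> r r' v b' le_r hd; have [hr _ _] := decides_program hd; move: hd.
    by rewrite /decides !(execution_finished _ _ _ _ hr) execution_finished // (leq_trans hr).
  + exists (size p); split; first exact: all_halted_program.
    by move=> v av; exists (dec (run f 0 p (fun v => ini v (x v)) v)); apply: decides_at_end.
- by exists (size p) => //; apply: all_halted_program.
- have [hB _] := H x f hf; exact: leq_trans (bits_sent_program _ _ _ _ _ _) hB.
Qed.

End Programs.

(** * Expanding families of permutations *)

Lemma leq_ffact_exp n k : n ^_ k <= n ^ k.
Proof.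
elim: k => [|k IH]; first by rewrite ffactn0.
by rewrite ffactnSr expnSr leq_mul // leq_subr.
Qed.

Lemma exp_leq_ffact n k : n ^ k <= (n + k) ^_ k.
Proof.
elim: k => [|k IH]; first by rewrite ffactn0.
by rewrite addnS ffactSS expnS leq_mul // (leq_trans (leq_addr k n)).
Qed.

Lemma leq_bin_exp2 n k : 'C(n, k) <= 2 ^ n.
Proof.
elim: n k => [|n IH] [|k]; rewrite ?bin0 ?bin0n ?expn_gt0 //.
by rewrite binS expnS mul2n -addnn leq_add.
Qed.

(** A weak form of Stirling's bound: [y ^ y] is at most the falling factorial of [2 * y], which is
    the central binomial coefficient times the factorial of [y]. *)
Lemma exp_leq_fact y : y ^ y <= 4 ^ y * y`!.
Proof.
apply: leq_trans (exp_leq_ffact y y) _; rewrite -bin_ffact leq_mul2r; apply/orP; right.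
by apply: leq_trans (leq_bin_exp2 _ _) _; rewrite addnn -mul2n expnM.
Qed.

(** The usual estimate [(4 * m / y) ^ y] of a binomial coefficient; allowing [u < y] lets one bound
    serve all smaller sizes. *)
Lemma bin_exp_leq m u y : u <= y <= m -> 'C(m, u) * y ^ y <= 4 ^ y * m ^ y.
Proof.
case/andP=> uy ym; apply: leq_trans (leq_mul (leqnn _) (exp_leq_fact y)) _.
rewrite mulnCA leq_mul2l; apply/orP; right.
rewrite -(ffact_fact (leq_subr u y)) subKn // mulnA mulnAC bin_ffact.
rewrite -{3}(subnKC uy) expnD leq_mul ?leq_ffact_exp //.
by apply: leq_trans (leq_ffact_exp _ _) _; case: (y - u) => [|k] //; rewrite leq_exp2r.
Qed.

Lemma ffact_exp_leq y m u : y <= m -> y ^_ u * m ^ u <= y ^ u * m ^_ u.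
Proof.
move=> ym; elim: u => [|u IH]; first by rewrite !ffactn0.
rewrite !ffactnSr !expnSr [X in X <= _]mulnACA [X in _ <= X]mulnACA leq_mul //.
by rewrite mulnBl mulnBr; apply: leq_sub2l; rewrite mulnC leq_mul.
Qed.

(** * Counting permutations and families of permutations *)

Section Counting.
Variables (T : finType).
Implicit Types (L U Y : {set T}).

Definition perms_into L U Y : {set {perm T}} :=
  [set s | perm_on L s & [forall x in U, s x \in Y]].

(** Induction on the size of [U]: for a fixed [x] in [U], sort the permutations by the image [z] of
    [x]. Composing with the transposition of [z] and [x] gives a permutation fixing [x], so the rest
    of [U] is treated inside [L :\ x]. *)
Lemma card_perms_into_ffact L U Y : U \subset L -> Y \subset L ->
  #|perms_into L U Y| <= #|Y| ^_ #|U| * (#|L| - #|U|)`!.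
Proof.
move: {2}#|U| (erefl #|U|) => u; elim: u L U Y => [|u IH] L U Y hu UL YL.
  rewrite hu ffactn0 mul1n subn0 -card_perm subset_leq_card //.
  by apply/subsetP => s; rewrite inE => /andP[].
have [x xU] : exists x, x \in U by apply/set0Pn; rewrite -card_gt0 hu.
have xL := subsetP UL x xU.
have hu' : #|U :\ x| = u by move: (cardsD1 x U); rewrite xU hu => -[].
have hL : #|L| = #|L :\ x|.+1 by rewrite (cardsD1 x L) xL.
rewrite hu hL subSS.
have step z : z \in Y ->
   #|[set s in perms_into L U Y | s x == z]| <= #|Y|.-1 ^_ u * (#|L :\ x| - u)`!.
  move=> zY; have zL := subsetP YL z zY.
  pose Y' := [set tperm z x y | y in Y :\ z].
  have cY' : #|Y'| = #|Y|.-1 by rewrite card_imset ?(cardsD1 z Y) ?zY //; apply: perm_inj.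
  have Y'L : Y' \subset L :\ x.
    apply/subsetP => w /imsetP[y]; rewrite !inE => /andP[yz yY] ->.
    have [e|ney] := eqVneq y x.
      by rewrite e tpermR zL andbT -e eq_sym.
    have -> : tperm z x y = y by rewrite tpermD // eq_sym.
    by rewrite ney (subsetP YL).
  have := IH (L :\ x) (U :\ x) Y' hu' (setSD _ UL) Y'L.
  rewrite hu' cY'; apply: leq_trans.
  rewrite -(card_imset _ (@mulIg _ (tperm z x))) subset_leq_card //.
  apply/subsetP => w /imsetP[s]; rewrite !inE => /andP[/andP[sL /forall_inP sU] /eqP sx] ->.
  apply/andP; split.
    apply/subsetP => v; rewrite !inE permM => hv.
    have [e|ne] := eqVneq v x; first by rewrite e sx tpermL eqxx in hv.
    apply: contraR hv => vL; rewrite (out_perm sL vL) tpermD //; last by rewrite eq_sym.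
    by apply: contraNneq vL => <-.
  apply/forall_inP => v; rewrite !inE => /andP[vx vU]; rewrite permM imset_f //.
  by rewrite !inE sU // andbT -sx (inj_eq perm_inj).
rewrite -sum1_card (partition_big (fun s : {perm T} => s x) (mem Y)) /=; last first.
  by move=> s; rewrite inE => /andP[_ /forall_inP]; apply.
apply: (@leq_trans (\sum_(z in Y) #|Y|.-1 ^_ u * (#|L :\ x| - u)`!)).
  apply: leq_sum => z zY; apply: leq_trans (step z zY).
  by rewrite -sum1_card; apply: eq_leq; apply: eq_bigl => s; rewrite !inE.
by rewrite sum_nat_const ffactnS mulnA.
Qed.

Lemma card_perms_into L U Y : U \subset L -> Y \subset L ->
  #|perms_into L U Y| * #|L| ^ #|U| <= #|Y| ^ #|U| * #|L|`!.
Proof.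
move=> UL YL; apply: leq_trans (leq_mul (card_perms_into_ffact UL YL) (leqnn _)) _.
rewrite mulnAC -(ffact_fact (subset_leq_card UL)) mulnA leq_mul //.
exact/ffact_exp_leq/subset_leq_card.
Qed.

Variable S : nat.
Local Notation family_type := {ffun 'I_S -> {perm T}}.
Implicit Types (W : {set T * 'I_S}).

Definition perm_families L : {set family_type} :=
  [set F : family_type | [forall j, perm_on L (F j)]].

Definition families_into L Y W : {set family_type} :=
  [set F : family_type | [forall j, perm_on L (F j)] & [forall q in W, F q.2 q.1 \in Y]].

Lemma card_perm_families L : #|perm_families L| = #|L|`! ^ S.
Proof.
have -> : #|perm_families L| = #|family (fun _ : 'I_S => perm_on L)|.
  by rewrite cardsE; apply: eq_card => F; rewrite !inE; apply/forallP/familyP.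
by rewrite card_family foldrE big_image /= prod_nat_const card_perm card_ord.
Qed.

(** The permutations are chosen independently, so the counts of [card_perms_into] multiply over the
    index [j]. As a probability, the bound is [(#|Y| / #|L|) ^ #|W|]. *)
Lemma card_families_into L Y W : Y \subset L -> (forall q, q \in W -> q.1 \in L) ->
  #|families_into L Y W| * #|L| ^ #|W| <= #|Y| ^ #|W| * #|L|`! ^ S.
Proof.
move=> YL WL; pose U j := [set x | (x, j) \in W].
have UL j : U j \subset L by apply/subsetP => x; rewrite inE => /WL.
have -> : #|families_into L Y W| = #|family (fun j : 'I_S => mem (perms_into L (U j) Y))|.
  rewrite cardsE; apply: eq_card => F; rewrite !inE; apply/andP/familyP.
    move=> [/forallP h1 /forall_inP h2] j; rewrite /= inE h1 /=.
    by apply/forall_inP => x; rewrite inE => /h2.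
  move=> h; split; first by apply/forallP => j; have := h j; rewrite /= inE => /andP[].
  apply/forall_inP => -[x j] xW /=; have := h j; rewrite /= inE => /andP[_ /forall_inP].
  by apply; rewrite inE.
have -> : #|W| = \sum_(j < S) #|U j|.
  rewrite -sum1_card (partition_big snd predT) //=; apply: eq_bigr => j _.
  rewrite -sum1_card (reindex (fun x : T => (x, j))) /=.
    by apply: eq_bigl => x; rewrite inE eqxx andbT.
  exists fst => [x|[x j']] //; by rewrite inE => /andP[_ /eqP /= ->].
rewrite card_family foldrE big_image /= !expn_sum.
have -> : #|L|`! ^ S = \prod_(j < S) #|L|`! by rewrite prod_nat_const card_ord.
rewrite -!big_split /=; apply: leq_prod => j _.
exact: card_perms_into.
Qed.

(** * The union bound *)

Section UnionBound.
Variables (L : {set T}) (E : {set T} -> {set T} -> {set {set T * 'I_S}}).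
Local Notation m := #|L|.
Definition event U Y W := [&& U \subset L, Y \subset L, 0 < #|U| <= #|Y| & W \in E U Y].

Hypothesis EL : forall U Y W q, event U Y W -> q \in W -> q.1 \in L.
(** With [y = #|Y|], an event has probability at most [(y / m) ^ #|W|], and all events of one pair
    [U], [Y] together at most [(y / m) ^ (2 * y) / 128 ^ y]. There are at most [(8 * m / y) ^ y]
    choices of [U] and [(4 * m / y) ^ y] choices of [Y] of size [y], which leaves [4 ^ y] in the
    denominator. *)
Hypothesis rare : forall U Y W, event U Y W ->
  #|E U Y| * 128 ^ #|Y| * m ^ (2 * #|Y|) * #|Y| ^ #|W| <= #|Y| ^ (2 * #|Y|) * m ^ #|W|.

Local Notation M := (m`! ^ S).
Local Notation bad Y := (\sum_(U : {set T} | (U \subset L) && (0 < #|U| <= #|Y|))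
    \sum_(W in E U Y) #|families_into L Y W|).

Lemma card_subsets_upto y : y <= m ->
  #|[set U : {set T} | (U \subset L) && (0 < #|U| <= y)]| * y ^ y <= 8 ^ y * m ^ y.
Proof.
move=> ym.
have h : #|[set U : {set T} | (U \subset L) && (0 < #|U| <= y)]| <= \sum_(1 <= u < y.+1) 'C(m, u).
  have -> : \sum_(1 <= u < y.+1) 'C(m, u) =
     \sum_(1 <= u < y.+1) #|[set U : {set T} | (U \subset L) && (#|U| == u)]|.
    by apply: eq_bigr => u _; rewrite cards_draws.
  elim: y {ym} => [|y IH].
    by rewrite big_geq // leqn0 cards_eq0; apply/eqP/setP => U; rewrite !inE; lia.
  rewrite big_nat_recr //=; apply: leq_trans (leq_add IH (leqnn _)).
  apply: leq_trans (leq_card_setU _ _); apply: subset_leq_card; apply/subsetP => U.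
  by rewrite !inE => /andP[-> /=]; lia.
apply: leq_trans (leq_mul h (leqnn _)) _; rewrite big_distrl /=.
apply: (@leq_trans (\sum_(1 <= u < y.+1) 4 ^ y * m ^ y)).
  rewrite big_nat_cond [X in _ <= X]big_nat_cond; apply: leq_sum => u.
  by rewrite andbT => /andP[_ hu]; apply: bin_exp_leq; rewrite ym andbT -ltnS.
rewrite sum_nat_const_nat subn1 /= mulnA leq_mul //.
(* The [y] possible sizes of [U] are absorbed in [2 ^ y]. *)
by rewrite -[8]/(2 * 4) expnMn leq_mul // ltnW // ltn_expl.
Qed.

Hypothesis m_gt0 : 0 < m.

Lemma bad_events Y : Y \subset L -> 0 < #|Y| ->
  bad Y * 16 ^ #|Y| * m ^ #|Y| <= #|Y| ^ #|Y| * M.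
Proof.
move=> YL Y0; set y := #|Y|; have ym : y <= m := subset_leq_card YL.
have hU U : (U \subset L) && (0 < #|U| <= y) ->
    (\sum_(W in E U Y) #|families_into L Y W|) * (128 ^ y * m ^ (2 * y)) <= y ^ (2 * y) * M.
  case/andP=> UL hu; have [->|[W0 W0E]] := set_0Vmem (E U Y).
    by rewrite big_set0 mul0n.
  have E0 : 0 < #|E U Y| by apply/card_gt0P; exists W0.
  rewrite -(leq_pmul2l E0) mulnA big_distrr /= big_distrl /= -sum_nat_const.
  apply: leq_sum => W WE; have ev : event U Y W by apply/and4P.
  have h2 := card_families_into YL (fun q => @EL U Y W q ev); have h1 := rare ev.
  have mw : 0 < m ^ #|W| by rewrite expn_gt0 m_gt0.
  rewrite -(leq_pmul2r mw); move: h1 h2; rewrite -/y.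
  move: #|E U Y| (128 ^ y) (m ^ (2 * y)) (y ^ #|W|) (m ^ #|W|) (y ^ (2 * y)) M #|families_into _ _ _|.
  move=> e a b c d g h k h1 h2.
  apply: (@leq_trans (e * a * b * (c * h))).
    by have := leq_mul (leqnn (e * a * b)) h2; rewrite !mulnA; lia.
  by have := leq_mul h1 (leqnn h); lia.
have := card_subsets_upto ym; set N := #|[set U | _]| => hN.
have : bad Y * (128 ^ y * m ^ (2 * y)) <= N * (y ^ (2 * y) * M).
  rewrite big_distrl /= /N -sum_nat_const; under [X in _ <= X]eq_bigl do rewrite inE.
  by apply: leq_sum => U /hU.
move: (bad Y) => b hb.
have my : 0 < m ^ y by rewrite expn_gt0 m_gt0.
have h8 : 0 < 8 ^ y by rewrite expn_gt0.
rewrite -(leq_pmul2r my) -(leq_pmul2r h8).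
have e1 : 128 ^ y = 16 ^ y * 8 ^ y by rewrite -expnMn.
have e2 k : k ^ (2 * y) = k ^ y * k ^ y by rewrite mulnC expnM -mulnn.
move: hb hN; rewrite e1 !e2.
move: (16 ^ y) (8 ^ y) (m ^ y) (y ^ y) M => A B C D G h1 h2.
have := leq_mul h2 (leqnn (D * G)).
by move: h1; rewrite !mulnA => h1 h3; nia.
Qed.

(** Sets of size [y] contribute at most [M / 4 ^ y], and the geometric series
    [1 / 4 + ... + 1 / 4 ^ k] equals [(1 - 1 / 4 ^ k) / 3]. *)
Lemma bad_total k : k <= m ->
  3 * 4 ^ k * (\sum_(1 <= y < k.+1) \sum_(Y : {set T} | (Y \subset L) && (#|Y| == y)) bad Y)
  <= (4 ^ k).-1 * M.
Proof.
elim: k => [|k IH] km; first by rewrite big_geq // muln0.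
rewrite big_nat_recr //=; have {IH} := IH (ltnW km).
set s := (\sum_(1 <= _ < _) _) => hs; set b := (\sum_(Y | _) _).
have hb : b * 4 ^ k.+1 <= M.
  have mk : 0 < m ^ k.+1 by rewrite expn_gt0 m_gt0.
  have k4 : 0 < 4 ^ k.+1 by rewrite expn_gt0.
  rewrite -(leq_pmul2r mk) -(leq_pmul2r k4).
  apply: (@leq_trans ('C(m, k.+1) * (k.+1 ^ k.+1 * M))).
    rewrite -cards_draws cardsE -sum_nat_const /b !big_distrl /=.
    apply: leq_sum => Y /andP[YL /eqP cY].
    have := bad_events YL; rewrite cY => /(_ isT).
    by rewrite -[16]/(4 * 4) expnMn mulnA => h; rewrite mulnAC.
  have := bin_exp_leq (m := m) (u := k.+1) (y := k.+1); rewrite leqnn km => /(_ isT).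
  by move/(fun h => leq_mul h (leqnn M)); lia.
have p4 : 0 < 4 ^ k by rewrite expn_gt0.
move: hs hb; rewrite expnS; move: (4 ^ k) p4 s b M => A A0 s b G h1 h2.
have -> : (4 * A).-1 = 4 * A.-1 + 3 by lia.
by nia.
Qed.

Lemma union_bound : exists F : family_type, (forall j, perm_on L (F j)) /\
  forall U Y W, event U Y W -> exists2 q, q \in W & F q.2 q.1 \notin Y.
Proof.
have M0 : 0 < M by rewrite expn_gt0 fact_gt0.
pose good F := [forall U, forall Y, forall W, event U Y W ==> (F \notin families_into L Y W)].
have [[F [hF /forallP hg]]|hno] : (exists F, F \in perm_families L /\ good F) \/
    (forall F, F \in perm_families L -> ~~ good F).
- case: (boolP [exists F, (F \in perm_families L) && good F]).
    by case/existsP=> F /andP[]; left; exists F.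
  by rewrite negb_exists => /forallP h; right=> F hF; have := h F; rewrite hF.
- move: hF; rewrite inE => /forallP hF; exists F; split=> // U Y W ev.
  have /forallP/(_ Y)/forallP/(_ W) := hg U; rewrite ev /= inE.
  have -> /= : [forall j, perm_on L (F j)] by apply/forallP.
  rewrite negb_forall_in => /exists_inP[q qW hq]; by exists q.
exfalso.
(* If no family is good, each is counted by at least one bad event; but [bad_total] makes this sum
   smaller than [M]. *)
have cov : M <= \sum_(Y : {set T} | (Y \subset L) && (0 < #|Y|)) bad Y.
  rewrite -card_perm_families -sum1_card.
  apply: (@leq_trans (\sum_(F in perm_families L)
    \sum_(Y : {set T} | (Y \subset L) && (0 < #|Y|))
      \sum_(U : {set T} | (U \subset L) && (0 < #|U| <= #|Y|)) \sum_(W in E U Y)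
        (F \in families_into L Y W))).
    apply: leq_sum => F /hno; rewrite /good.
    rewrite negb_forall => /existsP[U]; rewrite negb_forall => /existsP[Y].
    rewrite negb_forall => /existsP[W]; rewrite negb_imply negbK => /andP[].
    case/and4P=> UL YL hU hW hF.
    rewrite (bigD1 Y) /=; last by rewrite YL; lia.
    rewrite (bigD1 U) /=; last by rewrite UL.
    rewrite (bigD1 W) //= hF; lia.
  rewrite exchange_big /=; apply: leq_sum => Y _.
  rewrite exchange_big /=; apply: leq_sum => U _.
  rewrite exchange_big /=; apply: leq_sum => W _.
  rewrite -sum1_card [X in _ <= X]big_mkcond /= big_mkcond /=; apply: leq_sum => F _.
  by case: ifP; case: (F \in _).
have := bad_total (leqnn m).
have -> : \sum_(1 <= y < m.+1) \sum_(Y : {set T} | (Y \subset L) && (#|Y| == y)) bad Y =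
   \sum_(Y : {set T} | (Y \subset L) && (0 < #|Y|)) bad Y.
  rewrite (big_nat_widenl 1 0) // (big_nat_widen _ _ m.+1) // big_mkord.
  rewrite [RHS](partition_big (fun Y : {set T} => inord #|Y| : 'I_m.+1) (fun y => 0 < y)) /=.
    apply: eq_big => [y|y hy]; first by rewrite ltn_ord andbT.
    apply: eq_bigl => Y; case YL: (Y \subset L) => //=.
    rewrite -val_eqE /= inordK ?ltnS ?subset_leq_card //.
    by case: eqP => [->|]; rewrite ?andbT ?andbF //; lia.
  by move=> Y /andP[YL h0]; rewrite inordK // ltnS subset_leq_card.
move: cov; set s := (\sum_(Y | _) _) => cov h.
have p4 : 0 < 4 ^ m by rewrite expn_gt0.
by move: (4 ^ m) p4 h => A A0 h; nia.
Qed.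

End UnionBound.
End Counting.

(** * Numerical conditions for rarity *)

Lemma double_exp_leq a : 0 < a -> 2 * a ^ a <= a.+1 ^ a.
Proof.
move=> a0.
(* Bernoulli's inequality [1 + k / a <= (1 + 1 / a) ^ k], used at [k = a]. *)
suff h k : (a + k) * a ^ k <= a * a.+1 ^ k.
  by have := h a; rewrite addnn -mul2n -mulnA mulnCA leq_pmul2l.
elim: k => [|k IH]; first by rewrite !expn0 addn0.
rewrite expnSr [a.+1 ^ _]expnSr !mulnA.
apply: (@leq_trans ((a + k) * a ^ k * a.+1)); last by rewrite leq_mul2r IH orbT.
rewrite mulnAC -!mulnA [a ^ k * _]mulnC !mulnA leq_mul2r; apply/orP; right; nia.
Qed.

(* The rarity condition of [union_bound]; [m / y >= (a + 1) / a] gives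
   [(m / y) ^ (7 * a) >= 2 ^ 7 = 128]. *)
Lemma rare_exp a y m w : 0 < a -> 0 < y -> a.+1 * y <= a * m -> (7 * a + 2) * y <= w ->
  128 ^ y * m ^ (2 * y) * y ^ w <= y ^ (2 * y) * m ^ w.
Proof.
move=> a0 y0 ym hw; have le_ym : y <= m by nia.
have h2 : 2 * y ^ a <= m ^ a.
  have aa : 0 < a ^ a by rewrite expn_gt0 a0.
  rewrite -(leq_pmul2l aa) -[X in _ <= X]expnMn mulnCA mulnA.
  apply: leq_trans (leq_mul (double_exp_leq a0) (leqnn _)) _; rewrite -expnMn.
  by rewrite leq_exp2r.
have h128 : 128 * y ^ (7 * a) <= m ^ (7 * a).
  by rewrite -[128]/(2 ^ 7) mulnC [7 * a]mulnC !expnM -expnMn mulnC leq_exp2r.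
have -> : w = 2 * y + (7 * a * y + (w - (7 * a + 2) * y)) by nia.
rewrite !(expnD _ (2 * y)) !(expnD _ (7 * a * y)); set k := w - _.
have hk : y ^ k <= m ^ k by case: (k) => // i; rewrite leq_exp2r.
have hy : 128 ^ y * y ^ (7 * a * y) <= m ^ (7 * a * y).
  by rewrite [y ^ _]expnM [m ^ _]expnM -expnMn leq_exp2r.
have := leq_mul (leqnn (m ^ (2 * y) * y ^ (2 * y))) (leq_mul hy hk).
move: (128 ^ y) (m ^ (2 * y)) (y ^ (2 * y)) (y ^ (7 * a * y)) (m ^ (7 * a * y)) (y ^ k) (m ^ k).
by move=> A B C D G H I; lia.
Qed.

(** For events that are subsets of a set of [12 * e] pairs, of which there are [2 ^ (12 * e)]. Of
    the at least [i.+1 * e] pairs in an event, [i * e] pay for this number and [e] go to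
    [rare_exp]. *)
Lemma rare_dense a y m e w i : 0 < a -> 0 < y -> a.+1 * y <= a * m ->
  (7 * a + 2) * y <= e -> 2 ^ 12 * y ^ i <= m ^ i -> i.+1 * e <= w ->
  2 ^ (12 * e) * 128 ^ y * m ^ (2 * y) * y ^ w <= y ^ (2 * y) * m ^ w.
Proof.
move=> a0 y0 ym he hi hw; have le_ym : y <= m by nia.
have h := rare_exp a0 y0 ym he.
have e0 : 0 < e by nia.
have hi2 : 2 ^ (12 * e) * y ^ (i * e) <= m ^ (i * e).
  by rewrite [2 ^ _]expnM [y ^ _]expnM [m ^ _]expnM -expnMn leq_exp2r.
have -> : w = e + (i * e + (w - i.+1 * e)) by nia.
rewrite (expnD y e) (expnD m e) (expnD y (i * e)) (expnD m (i * e)).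
have hr : y ^ (w - i.+1 * e) <= m ^ (w - i.+1 * e) by case: (w - _) => // k; rewrite leq_exp2r.
have := leq_mul h (leq_mul hi2 hr).
move: (2 ^ (12 * e)) (128 ^ y) (m ^ (2 * y)) (y ^ e) (y ^ (i * e)) (y ^ (w - _)).
move: (m ^ (w - _)) (m ^ (i * e)) (m ^ e) (y ^ (2 * y)).
by move=> A1 A2 A3 A4 B1 B2 B3 B4 B5 B6; lia.
Qed.

(* Large enough for the union bounds below; locked, lest conversion should turn
   the multiples of it into unary numerals. *)
Definition expansion := locked (7 * 63 + 2).

Lemma expansionE : expansion = 7 * 63 + 2.
Proof. by rewrite /expansion -lock. Qed.

Lemma expansion_gt0 : 0 < expansion.
Proof. by rewrite expansionE. Qed.

(** The edges from [v] lead to the nodes [sigma j v]. The first clause provides an edge between two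
    large sets, [Y] being the complement of one of them; the second limits the damage of crashes in
    [exists_core]; the third makes the survivors double in [survivors_double]. *)
Definition expander (T : finType) (L : {set T}) e (sigma : nat -> {perm T}) :=
  (forall j, perm_on L (sigma j)) /\
  forall U Y : {set T}, U \subset L -> Y \subset L -> 0 < #|U| ->
    expansion * #|Y| <= e * #|U| ->
  [/\ 64 * #|Y| <= 63 * #|L| -> exists2 v, v \in U & exists2 j, j < 12 * e & sigma j v \notin Y,
      #|U| <= #|Y| -> 3 * #|Y| <= #|L| ->
        4 * \sum_(v in U) #|[set j : 'I_(12 * e) | sigma j v \in Y]| < 3 * (12 * e * #|U|)
    & #|U| <= #|Y| -> 64 * #|Y| <= #|L| ->
        4 * \sum_(v in U) #|[set j : 'I_(12 * e) | sigma j v \in Y]| < 12 * e * #|U| ].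

(** A single family serves every number [s] of inquiries: a shorter prefix is compensated by a
    larger ratio of [U] to [Y]. *)
Definition prefix_expander (T : finType) N (rho : nat -> {perm T}) :=
  forall (U Y : {set T}) s, 0 < #|U| -> 0 < s <= N ->
  64 * #|Y| <= 63 * #|T| -> expansion * #|Y| <= s * #|U| ->
  exists2 v, v \in U & exists2 j, j < s & rho j v \notin Y.

Lemma perm_not_into (T : finType) (s : {perm T}) (U Y : {set T}) :
  #|Y| < #|U| -> exists2 v, v \in U & s v \notin Y.
Proof.
move=> h; apply/exists_inP; rewrite -negb_forall_in; apply: contraL h => /forall_inP h.
rewrite -leqNgt -(card_imset _ (@perm_inj _ s)) subset_leq_card //.
by apply/subsetP => w /imsetP[v /h hv ->].
Qed.

Lemma exists_prefix_expander (T : finType) N : 0 < #|T| ->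
  exists rho : nat -> {perm T}, prefix_expander N rho.
Proof.
rewrite -cardsT => L0; set L := [set: T] in L0.
(* The least admissible [s] is the quotient rounded up; larger [s] only add permutations, so one
   event for each pair [U], [Y] suffices. *)
pose len (U Y : {set T}) := (expansion * #|Y| + #|U|.-1) %/ #|U|.
pose pre (U Y : {set T}) := [set q : T * 'I_N | (q.1 \in U) && (q.2 < len U Y)].
pose E (U Y : {set T}) :=
  if (64 * #|Y| <= 63 * #|L|) && (len U Y <= N) then [set pre U Y] else set0.
have lenP (U Y : {set T}) s : 0 < #|U| -> (expansion * #|Y| <= s * #|U|) = (len U Y <= s).
  move=> u0; rewrite -ltnS -[X in _ = X]ltnS /len ltn_divLR //.
  by move: (expansion * _) => k; rewrite mulSn; lia.
have evE U Y W : event L E U Y W -> [/\ U \subset L, 0 < #|U|, 0 < #|Y|,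
    64 * #|Y| <= 63 * #|L| & len U Y <= N] /\ W = pre U Y.
  case/and4P=> UL YL /andP[u0 uy]; rewrite /E; case: ifP; last by rewrite inE.
  by case/andP=> h1 h2; rewrite inE => /eqP ->; do 2!split=> //; apply: leq_trans uy.
have [F [FL hF]] : exists F : {ffun 'I_N -> {perm T}}, (forall j, perm_on L (F j)) /\
  forall U Y W, event L E U Y W -> exists2 q, q \in W & F q.2 q.1 \notin Y.
  apply: union_bound => // U Y W /evE[[_ u0 y0 h64 hlen] ->].
  have -> : #|E U Y| = 1 by rewrite /E h64 hlen cards1.
  rewrite mul1n; apply: (@rare_exp 63) => //.
  have -> : #|pre U Y| = len U Y * #|U|.
    have -> : pre U Y = setX U [set j : 'I_N | j < len U Y].
      by apply/setP => -[v j]; rewrite !inE.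
    rewrite cardsX mulnC; congr (_ * _).
    rewrite -sum1_card; under eq_bigl do rewrite inE.
    by rewrite -(big_ord_widen N (fun=> 1) hlen) sum1_card card_ord.
  by rewrite -expansionE lenP.
exists (fun j => if insub j is Some i then F i else 1%g) => U Y s u0 sN h64 hs.
rewrite -cardsT -/L in h64; case/andP: sN => s0 sN.
(* The union bound covers only [#|U| <= #|Y|]; a larger [U] does not fit into [Y] even under one
   permutation. *)
have [yu|uy] := ltnP #|Y| #|U|.
  have [v vU hv] := perm_not_into (F (Ordinal (leq_trans s0 sN))) yu.
  exists v => //; exists 0; rewrite // insubT ?(leq_trans s0 sN) // => p.
  by rewrite (bool_irrelevance p (leq_trans s0 sN)).
rewrite lenP // in hs; have ev : event L E U Y (pre U Y).
  by apply/and4P; split; rewrite ?subsetT ?u0 // /E h64 (leq_trans hs sN) inE.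
have [[v j]] := hF _ _ _ ev; rewrite inE /= => /andP[vU hj] nY.
by exists v => //; exists (val j); [apply: leq_trans hs | rewrite valK].
Qed.

Section Expanders.
Variables (T : finType) (L : {set T}).
Hypothesis L0 : 0 < #|L|.

Lemma exists_expander e : 0 < e -> exists sigma, expander L e sigma.
Proof.
move=> e0; set d := 12 * e; have d0 : 0 < d by rewrite muln_gt0.
pose box (U : {set T}) := setX U [set: 'I_d].
have cbox U : #|box U| = 12 * (e * #|U|) by rewrite cardsX cardsT card_ord mulnC mulnA.
(* For a dense [Y], the only event is that all edges enter it. For [#|Y| <= #|L| / 3] and
   [#|Y| <= #|L| / 64], the events are the sets of at least three quarters and one quarter of the
   edges. The factor 12 gives [rare_dense] the exponents 8 and 2, and [3 ^ 8 >= 2 ^ 12],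
   [64 ^ 2 = 2 ^ 12]. *)
pose E (U Y : {set T}) : {set {set T * 'I_d}} :=
  if expansion * #|Y| <= e * #|U| then
    if #|L| < 3 * #|Y| then if 64 * #|Y| <= 63 * #|L| then [set box U] else set0
    else [set W : {set T * 'I_d} | (W \subset box U) &
      if #|L| < 64 * #|Y| then 9 * (e * #|U|) <= #|W| else 3 * (e * #|U|) <= #|W|]
  else set0.
have [F [FL hF]] : exists F : {ffun 'I_d -> {perm T}}, (forall j, perm_on L (F j)) /\
  forall U Y W, event L E U Y W -> exists2 q, q \in W & F q.2 q.1 \notin Y.
  apply: union_bound => // [U Y W q|U Y W] /and4P[UL YL /andP[u0 uy]]; rewrite /E.
    have hb : q \in box U -> q.1 \in L by rewrite !inE andbT => /(subsetP UL).
    case: ifP; last by rewrite inE.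
    move=> _; case: ifP => _; last by rewrite inE => /andP[/subsetP hW _ /hW].
    by case: ifP; rewrite inE // => _ /eqP ->.
  have y0 : 0 < #|Y| by apply: leq_trans uy.
  case: ifP => hK; last by rewrite inE.
  case: ifP => h3.
    case: ifP => h64; rewrite inE // => /eqP ->; rewrite cards1 mul1n.
    apply: (@rare_exp 63) => //; rewrite -expansionE cbox; apply: leq_trans hK _; lia.
  set A := [set W0 | _]; rewrite inE => /andP[_ hW].
  have hA : #|A| <= 2 ^ (12 * (e * #|U|)).
    rewrite -cbox -card_powerset subset_leq_card //.
    by apply/subsetP => W0; rewrite !inE => /andP[].
  apply: (@leq_trans (2 ^ (12 * (e * #|U|)) * 128 ^ #|Y| * #|L| ^ (2 * #|Y|) * #|Y| ^ #|W|)).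
    by do 3!apply: leq_mul => //.
  move: hW; case: ifP => h64 hW.
    apply: (@rare_dense 63 _ _ (e * #|U|) _ 8) => //; [by lia | by rewrite -expansionE |].
    have h9 : 8 * #|Y| ^ 2 <= #|L| ^ 2 by rewrite -!mulnn; nia.
    by rewrite -[8]/(2 * 4) ![_ ^ (2 * 4)]expnM -[2 ^ 12]/(8 ^ 4) -expnMn leq_exp2r.
  apply: (@rare_dense 63 _ _ (e * #|U|) _ 2) => //; [by lia | by rewrite -expansionE |].
  by rewrite -[2 ^ 12]/(64 ^ 2) -expnMn leq_exp2r //; lia.
pose sigma j := if insub j is Some i then F i else 1%g.
have sigE (i : 'I_d) : sigma i = F i by rewrite /sigma valK.
have cW (U Y : {set T}) : \sum_(v in U) #|[set j : 'I_d | sigma j v \in Y]| =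
   #|[set q in box U | F q.2 q.1 \in Y]|.
  rewrite -[RHS]sum1_card (partition_big (fun q : T * 'I_d => q.1) (mem U)) /=; last first.
    by move=> q; rewrite !inE => /andP[/andP[]].
  apply: eq_bigr => v vU; rewrite -sum1_card (reindex (fun j : 'I_d => (v, j))) /=.
    by apply: eq_bigl => j; rewrite !inE eqxx vU sigE andbT.
  by exists snd => [j|[v' j]] //; rewrite inE /= => /andP[_ /eqP /= ->].
exists sigma; split=> [j|U Y UL YL u0 hK].
  by rewrite /sigma; case: insub => [i|]; [apply: FL | apply: perm_on1].
have key (W : {set T * 'I_d}) : #|U| <= #|Y| -> W \in E U Y ->
    exists2 q, q \in W & F q.2 q.1 \notin Y.
  by move=> uy hW; apply: hF (U) (Y) _ _; apply/and4P; rewrite u0.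
split=> [h64|uy h3|uy h64].
- have [yu|uy] := ltnP #|Y| #|U|.
    have [v vU hv] := perm_not_into (F (Ordinal d0)) yu.
    by exists v => //; exists 0 => //; rewrite -(sigE (Ordinal d0)) in hv.
  suff [[v j] hq nY] : exists2 q, q \in box U & F q.2 q.1 \notin Y.
    exists v; first by move: hq; rewrite !inE => /andP[].
    by exists j => //; rewrite sigE.
  apply: key => //; rewrite /E hK; case: ifP => h3; first by rewrite h64 inE.
  by rewrite inE subxx cbox /=; case: ifP => _; apply: leq_mul.
- rewrite cW ltnNge; apply/negP => hc.
  have [|q] := key [set q in box U | F q.2 q.1 \in Y] uy; last first.
    by rewrite inE => /andP[_ ->].
  rewrite /E hK ltnNge h3 /= inE; apply/andP; split.
    by apply/subsetP => q; rewrite inE => /andP[].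
  have h9 : 9 * (e * #|U|) <= #|[set q in box U | F q.2 q.1 \in Y]|.
    by move: hc; rewrite /d; lia.
  by case: ifP => // _; apply: leq_trans h9; lia.
- rewrite cW ltnNge; apply/negP => hc.
  have [|q] := key [set q in box U | F q.2 q.1 \in Y] uy; last first.
    by rewrite inE => /andP[_ ->].
  rewrite /E hK; case: ifP => [|_]; first by lia.
  rewrite inE ltnNge h64 /=; apply/andP; split.
    by apply/subsetP => q; rewrite inE => /andP[].
  by rewrite -(leq_pmul2l (isT : 0 < 4)); apply: leq_trans hc; rewrite /d; lia.
Qed.

End Expanders.

(** * The phases of the algorithm *)

(* [turn] is the round in which a node starts to forward the value 1, [count]
   and [active] belong to the probing, [sure] is the common value once the node
   knows it, and [asked] records an inquiry received in the previous round. *)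
Record node := Node {
  input : bool;
  turn : option nat;
  count : nat;
  active : bool;
  sure : option bool;
  asked : bool
}.

Section Phases.
Variables (n : nat) (f : crash_schedule n).
Local Notation config := ('I_n -> node).
Local Notation rnd := (round n node).
Implicit Types (c : config) (r : nat).

Definition unsure r c : {set 'I_n} := [set v | alive f r v && (sure (c v) == None)].

(** Nodes that crash at any time are included, whatever the round, so every node outside this set
    can be counted on to answer all inquiries. *)
Definition unreliable c : {set 'I_n} := [set v | (f v != None) || (sure (c v) == None)].

(** Knowledge is neither lost nor invented, so agreement among the nodes that know the value is
    preserved. *)
Definition spreads c c' :=
  (forall v b, sure (c v) = Some b -> sure (c' v) = Some b) /\
  (forall v b, sure (c' v) = Some b -> exists w, sure (c w) = Some b).

Lemma spreads_refl c : spreads c c.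
Proof. by split=> // v b h; exists v. Qed.

Lemma spreads_trans c1 c2 c3 : spreads c1 c2 -> spreads c2 c3 -> spreads c1 c3.
Proof.
move=> [h1 h2] [h3 h4]; split=> [v b /h1/h3 //|v b /h4[w /h2]] //.
Qed.

(** * Flooding *)

Section Flooding.
Variables (sigma : nat -> {perm 'I_n}) (d m : nat).
Local Notation D := (2 * d).

(* A node that starts to forward in round [a] is active in the rounds [a], ...,
   [a + D - 1], during which each of the [D] permutations is used once. *)
Definition flood_perm i : {perm 'I_n} :=
  if i %% D < d then sigma (i %% D) else (sigma (i %% D - d))^-1%g.

Definition forwarding i (s : node) : bool := if turn s is Some a then a <= i < a + D else false.

Definition flood_round i : rnd :=
  Round (flood_perm i) (fun _ s => if forwarding i s then Some true else None)
    (fun _ s b => if (b == None) || (turn s != None) then s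
                  else Node (input s) (Some i.+1) (count s) (active s) (sure s) (asked s)).

Definition flood := mkseq flood_round (D * m).

Variables (r0 : nat) (c0 : config) (L : {set 'I_n}).
Hypothesis sigmaL : forall j, perm_on L (sigma j).
Hypothesis turn0 : forall v a, turn (c0 v) = Some a -> a = 0 /\ v \in L.
Hypothesis cardL : #|L| = m.
Hypothesis d0 : 0 < d.

Local Notation C i := (run f r0 (mkseq flood_round i) c0).

Lemma flood_permL i : perm_on L (flood_perm i).
Proof.
by rewrite /flood_perm; case: ifP => _ //; apply: perm_onV.
Qed.

Lemma flood_step i v : C i.+1 v = C i v \/
  [/\ turn (C i v) = None,
      forwarding i (C i ((flood_perm i)^-1%g v)),
      completes f (r0 + i) v
    & C i.+1 v = Node (input (C i v)) (Some i.+1) (count (C i v)) (active (C i v))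
                   (sure (C i v)) (asked (C i v))].
Proof.
rewrite run_mkseqS /round_step; case: ifP => hc; last by left.
rewrite [rupd _ _ _ _]/=; case E: (heard _ _ _ _ _) => [b|]; last by left.
case T: (turn (C i v)) => [a|]; first by left.
have [_ /=] := heard_Some E; case: ifP => // fw _; right; split=> //.
Qed.

Lemma flood_same i v : [/\ input (C i v) = input (c0 v), active (C i v) = active (c0 v)
   & sure (C i v) = sure (c0 v)].
Proof.
elim: i => [//|i [h1 h2 h3]].
by case: (flood_step i v) => [->|[_ _ _ ->]].
Qed.

Lemma turn_stable i i' v a : i <= i' -> turn (C i v) = Some a -> turn (C i' v) = Some a.
Proof.
move=> /subnKC <-; elim: (i' - i) => [|k IH]; first by rewrite addn0.
by rewrite addnS => /IH {}IH; case: (flood_step (i + k) v) => [->|[]] //; rewrite IH.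
Qed.

Lemma turn_L i v a : turn (C i v) = Some a -> v \in L.
Proof.
elim: i v a => [|i IH] v a; first by move/turn0 => [].
case: (flood_step i v) => [-> /IH //|[_ hf _ _] _].
apply: contraLR hf => vL; have vfix : (flood_perm i)^-1%g v = v.
  by apply: out_perm vL; apply: perm_onV; apply: flood_permL.
rewrite vfix /forwarding; case E: (turn (C i v)) => [b|] //.
by rewrite (IH _ _ E) in vL.
Qed.

Lemma turn_cause i v a : turn (C i v) = Some a -> a <= i /\ (a = 0 \/
  exists u b, [/\ turn (C i u) = Some b, b < a & a <= b + D]).
Proof.
elim: i v a => [|i IH] v a; first by move/turn0 => [->]; split=> //; left.
have mono u b : turn (C i u) = Some b -> turn (C i.+1 u) = Some b by apply: turn_stable.
case: (flood_step i v) => [-> /IH[h1 h2]|[_ hf _ -> /= [<-]]].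
  split; first exact: leq_trans h1 _.
  case: h2 => [|[u [b [h3 h4 h5]]]]; [by left|right].
  by exists u, b; split=> //; apply: mono.
split=> //; right; move: hf; rewrite /forwarding.
case E: (turn _) => [b|] // /andP[h1 h2]; exists ((flood_perm i)^-1%g v), b.
by split=> //; apply: mono.
Qed.

(** Tracing a turn [a] back through [turn_cause], each step goes back by at most [D] rounds and
    strictly shrinks the set of nodes with a turn up to that time. Hence [a + D <= D * #|A a|],
    however the crashes delay the flooding. *)
Lemma turn_bound i v a : turn (C i v) = Some a -> a + D <= D * m.
Proof.
set A := fun a => [set w | if turn (C i w) is Some b then b <= a else false].
have AL b : A b \subset L.
  apply/subsetP => w; rewrite inE; case E: (turn _) => [b'|] // _; exact: turn_L E.
suff h : turn (C i v) = Some a -> a + D <= D * #|A a|.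
  by move=> /h {}h; apply: leq_trans h _; rewrite leq_mul2l -cardL subset_leq_card ?AL ?orbT.
elim/ltn_ind: a v => a IH v hv; have vA : v \in A a by rewrite inE hv.
have [_ [a0|[u [b [hu ba ab]]]]] := turn_cause hv.
  by rewrite {1}a0 add0n leq_pmulr //; apply/card_gt0P; exists v.
have := IH b ba u hu.
have : A b \proper A a.
  apply/properP; split; last by exists v => //; rewrite inE hv -ltnNge.
  by apply/subsetP => w; rewrite !inE; case: (turn _) => // b' h; apply: leq_trans h (ltnW ba).
by move/proper_card => h1 h2; nia.
Qed.

Lemma flood_perm_hits a p : (exists2 j, j < d & p = sigma j \/ p = (sigma j)^-1%g) ->
  exists2 i, a <= i < a + D & flood_perm i = p.
Proof.
have D0 : 0 < D by rewrite muln_gt0.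
have hit k : k < D -> exists2 i, a <= i < a + D & i %% D = k.
  move=> kD; exists (a + (k + D - a %% D) %% D).
    by rewrite leq_addr ltn_add2l ltn_pmod.
  rewrite modnDmr addnBA; last by apply: leq_trans (leq_addl _ _); apply/ltnW/ltn_pmod.
  have -> : a + (k + D) - a %% D = a %/ D * D + (k + D).
    by rewrite {1}(divn_eq a D) addnAC addnK.
  by rewrite modnMDl modnDr modn_small.
case=> j jd [] ->.
  have [|i hi e] := hit j; first by lia.
  by exists i; rewrite // /flood_perm e jd.
have [|i hi e] := hit (j + d); first by lia.
by exists i; rewrite // /flood_perm e ltnNge leq_addl /= addnK.
Qed.

(** By [turn_bound], the whole forwarding window of [v] lies within the flooding, and some round of
    it uses the permutation [p]. *)
Lemma flood_closed v p : (exists2 j, j < d & p = sigma j \/ p = (sigma j)^-1%g) ->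
  alive f (r0 + D * m) v -> alive f (r0 + D * m) (p v) ->
  turn (C (D * m) v) != None -> turn (C (D * m) (p v)) != None.
Proof.
move=> hp av apv; case E: (turn _) => [a|] // _.
have [i /andP[ai ia] ip] := flood_perm_hits a hp.
have aD := turn_bound E; have iD : i < D * m by apply: leq_trans ia aD.
(* A turn acquired in round [i] or later exceeds [i], so the turn [a] is already set. *)
have Ei : turn (C i v) = Some a.
  case Ei: (turn (C i v)) => [a'|]; first by have := turn_stable (ltnW iD) Ei; rewrite E.
  have nz k : i <= k -> turn (C k v) = Some a -> False.
    move=> /subnKC <-; elim: (k - i) => [|q IH]; first by rewrite addn0 Ei.
    rewrite addnS; case: (flood_step (i + q) v) => [->|[_ _ _ ->]] //= [e].
    by move: ai; rewrite -e; lia.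
  by case: (nz _ (ltnW iD) E).
suff : turn (C i.+1 (p v)) != None.
  by case E': (turn _) => [b|] // _; rewrite (turn_stable iD E').
have cpv : completes f (r0 + i) (p v).
  by rewrite completesE; apply: alive_le apv; rewrite -addnS leq_add2l.
have cv : can_send f (r0 + i) v.
  by apply: alive_can_send; apply: alive_le av; rewrite -addnS leq_add2l.
rewrite run_mkseqS /round_step cpv /heard /= ip permK cv /forwarding Ei ai ia /=.
by case E': (turn (C i (p v))) => [b|] //=; rewrite E'.
Qed.

Lemma flood_uniform v j : j < d -> alive f (r0 + D * m) v -> alive f (r0 + D * m) (sigma j v) ->
  (turn (C (D * m) v) != None) = (turn (C (D * m) (sigma j v)) != None).
Proof.
move=> jd a1 a2; apply/idP/idP => h; first by apply: flood_closed => //; exists j; auto.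
rewrite -(permK (sigma j) v); apply: flood_closed => //; rewrite ?permK //.
by exists j; auto.
Qed.

Lemma flood_origin i v : turn (C i v) != None -> exists w, turn (c0 w) != None.
Proof.
elim: i v => [|i IH] v; first by exists v.
case: (flood_step i v) => [-> /IH //|[_ hf _ _] _].
by apply: (IH ((flood_perm i)^-1%g v)); move: hf; rewrite /forwarding; case: (turn _).
Qed.

Lemma flood_keeps i v : turn (c0 v) != None -> turn (C i v) != None.
Proof.
case E: (turn (c0 v)) => [a|] // _; by rewrite (@turn_stable 0 i v a).
Qed.

Lemma flood_traffic : traffic f r0 flood c0 <= D * m.
Proof.
(* The windows are read off from the final turns, so that they do not change with the round. *)
pose ind i v := if turn (C (D * m) v) is Some a then a <= i < a + D else false.
suff h k : k <= D * m ->
    traffic f r0 (mkseq flood_round k) c0 <= \sum_(v in L) \sum_(i < k) ind i v.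
  apply: leq_trans (h _ (leqnn _)) _; rewrite -[X in _ <= D * X]cardL [D * #|_|]mulnC -sum_nat_const.
  apply: leq_sum => v _; rewrite /ind; case: (turn _) => [a|]; last by rewrite big1.
  rewrite -(big_mkord predT (fun i => (a <= i < a + D : nat))) -big_mkcond /=.
  rewrite sum1_count -size_filter.
  apply: (@leq_trans (size (iota a D))); last by rewrite size_iota.
  apply: uniq_leq_size; first by rewrite filter_uniq // iota_uniq.
  by move=> i; rewrite mem_filter mem_iota => /andP[].
elim: k => [|k IH] kD; first by rewrite big1 // => v _; rewrite big_ord0.
rewrite traffic_mkseqS; under eq_bigr do rewrite big_ord_recr /=.
rewrite big_split /=; apply: leq_add; first exact: IH (ltnW kD).
rewrite -sum1_card [X in _ <= X]big_mkcond [X in X <= _]big_mkcond /=; apply: leq_sum => v _.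
rewrite inE /= /forwarding; case: ifP => //= /andP[_]; case: ifP => //.
case E: (turn _) => [a|] // h _.
by rewrite (turn_L E) /ind (turn_stable (ltnW kD) E) h.
Qed.

End Flooding.

(** * Probing *)

Section Probing.
Variables (sigma : nat -> {perm 'I_n}) (d : nat).

(** The permutation is inverted so that [v] hears from [sigma j v]. Nodes drop out only in the last
    round, so a whole probe sees one and the same [active]. *)
Definition probe_round j : rnd :=
  Round (sigma j)^-1%g (fun _ s => if active s then Some true else None)
    (fun _ s b =>
       let k := (if j == 0 then 0 else count s) + (b != None) in
       Node (input s) (turn s) k (if j.+1 == d then active s && (d <= 4 * k) else active s)
         (sure s) (asked s)).

Definition probe := mkseq probe_round d.

Variables (r : nat) (c : config).
Local Notation C i := (run f r (mkseq probe_round i) c).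
Local Notation hears i v :=
  (\sum_(j < i) (can_send f (r + j) (sigma j v) && active (c (sigma j v)) : nat)).

Lemma probe_inv i v : i < d -> [/\ active (C i v) = active (c v), turn (C i v) = turn (c v),
   sure (C i v) = sure (c v) & 0 < i -> alive f (r + i) v -> count (C i v) = hears i v].
Proof.
elim: i v => [//|i IH] v id; have {}IH w := IH w (ltnW id).
have [h1 h2 h3 h4] := IH v.
rewrite run_mkseqS /round_step; case: ifP => hc /=; last first.
  by split=> // _; rewrite addnS -completesE hc.
have -> : (i.+1 == d) = false by lia.
split=> // _ av; rewrite big_ord_recr /= /heard /= invgK.
have [g1 _ _ _] := IH (sigma i v); rewrite g1; congr (_ + _).
  case: posnP => [->|i0]; first by rewrite big_ord0.
  by rewrite h4 // (alive_le _ av) // addnS.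
by case: can_send => //=; case: active.
Qed.

Hypothesis d0 : 0 < d.

Lemma probe_spec v : let c' := run f r probe c in
  [/\ turn (c' v) = turn (c v), sure (c' v) = sure (c v),
      ~~ alive f (r + d) v -> active (c' v) = active (c v)
    & alive f (r + d) v -> active (c' v) = active (c v) && (d <= 4 * hears d v)].
Proof.
have [k dk] : exists k, d = k.+1 by case: (d) d0 => // k _; exists k.
have inv w : _ := @probe_inv k w (eq_leq (esym dk)).
have [h1 h2 h3 h4] := inv v.
have -> : probe = mkseq probe_round k.+1 by rewrite -dk.
have -> : hears d v = hears k.+1 v by rewrite -dk.
have -> : r + d = (r + k).+1 by rewrite dk addnS.
rewrite run_mkseqS /round_step completesE.
case: ifP => av /=; last by split.
rewrite -dk eqxx; split=> //; rewrite ?h1 // dk big_ord_recr /= /heard /= invgK => _.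
have [g1 _ _ _] := inv (sigma k v); rewrite g1; congr (_ && (_ <= 4 * (_ + _))).
  case: posnP => [->|k0]; first by rewrite big_ord0.
  by rewrite h4 // (alive_le _ av).
by case: can_send => //=; case: active.
Qed.

Lemma sum_ord_card (P : pred nat) : \sum_(j < d) (P j : nat) = #|[set j : 'I_d | P j]|.
Proof.
rewrite -sum1_card [RHS]big_mkcond /=; apply: eq_bigr => j _.
by rewrite inE; case: (P j).
Qed.

(** Responders were alive when the probe started. The counterpart [probe_complete] counts only those
    alive when it ends; nodes that crash in between may or may not be heard. *)
Lemma probe_sound v : alive f (r + d) v -> active (run f r probe c v) ->
  active (c v) /\
  d <= 4 * #|[set j : 'I_d | alive f r (sigma j v) && active (c (sigma j v))]|.
Proof.
move=> av; have [_ _ _ ->//] := probe_spec v => /andP[-> h]; split=> //.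
apply: leq_trans h _; rewrite leq_mul2l /=.
rewrite -(sum_ord_card (fun j => alive f r (sigma j v) && active (c (sigma j v)))).
apply: leq_sum => j _.
case: (active _); rewrite ?andbF // !andbT; case hs: (can_send _ _ _) => //.
by rewrite (alive_le _ (can_send_alive hs)) // leq_addr.
Qed.

Lemma probe_complete v : active (c v) ->
  d <= 4 * #|[set j : 'I_d | alive f (r + d) (sigma j v) && active (c (sigma j v))]| ->
  active (run f r probe c v).
Proof.
move=> ac h; have [_ _ h1 h2] := probe_spec v.
case av: (alive f (r + d) v); last by rewrite h1 // av.
rewrite h2 // ac; apply: leq_trans h _; rewrite leq_mul2l /=.
rewrite -(sum_ord_card (fun j => alive f (r + d) (sigma j v) && active (c (sigma j v)))).
apply: leq_sum => j _.
case: (active _); rewrite ?andbF // !andbT; case hs: (alive _ _ _) => //.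
by rewrite alive_can_send // (alive_le _ hs) // -addnS leq_add2l.
Qed.

Lemma probe_antimono v : active (run f r probe c v) -> active (c v).
Proof.
have [_ _ h1 h2] := probe_spec v; case av: (alive f (r + d) v); last by rewrite h1 // av.
by rewrite h2 // => /andP[].
Qed.

Lemma probe_traffic (L : {set 'I_n}) : (forall v, active (c v) -> v \in L) ->
  traffic f r probe c <= d * #|L|.
Proof.
move=> cL; suff h i : i <= d -> traffic f r (mkseq probe_round i) c <= i * #|L| by apply: h.
elim: i => [//|i IH] id; rewrite traffic_mkseqS mulSn addnC.
apply: leq_add; last exact: IH (ltnW id).
rewrite subset_leq_card //; apply/subsetP => v; rewrite inE /= => /andP[_].
by have [-> _ _ _] := probe_inv v id; case E: active => // _; apply: cL.
Qed.

End Probing.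

Definition commit_round : rnd :=
  Round 1%g (fun _ _ => None)
    (fun _ s _ => Node (input s) (turn s) (count s) (active s)
                    (if active s then Some (turn s != None) else None) (asked s)).

Definition learn (s : node) (b : option bool) : node :=
  if sure s is None then Node (input s) (turn s) (count s) (active s) b (asked s) else s.

Lemma sure_learn s b : sure (learn s b) = if sure s is Some x then Some x else b.
Proof. by rewrite /learn; case E: (sure s). Qed.

(** * Doubling along residue classes *)

Section Doubling.
Variable m : nat.

Lemma shift_proof a (v : 'I_n) : (v + a) %% n < n.
Proof. by rewrite ltn_pmod //; case: v => v /=; case: n. Qed.

Lemma shift_inj a : injective (fun v => Ordinal (shift_proof a v)).
Proof.
move=> v w /(congr1 val) /= /eqP; rewrite eqn_modDr !modn_small // => /eqP h.
exact: val_inj.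
Qed.

Definition shift a : {perm 'I_n} := perm (@shift_inj a).

(** The shift is cyclic to be a permutation, but nobody sends across the wrap-around. *)
Definition double_round k : rnd :=
  Round (shift (m * 2 ^ k))
    (fun v s => if (v < m * 2 ^ k) && (v + m * 2 ^ k < n) then sure s else None)
    (fun _ s b => learn s b).

Variables (r : nat) (c : config).
Local Notation C i := (run f r (mkseq double_round i) c).

Lemma double_spreads i : spreads c (C i).
Proof.
elim: i => [|i IH]; first exact: spreads_refl.
apply: spreads_trans IH _; rewrite run_mkseqS /round_step; split=> v b.
  by case: ifP => _ //= h; rewrite sure_learn h.
case: ifP => _ /=; last by exists v.
rewrite sure_learn; case E: (sure _) => [x|]; first by rewrite -E; exists v.
by move/heard_Some => [_ /=]; case: ifP => // _ h; exists (((shift (m * 2 ^ i))^-1)%g v).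
Qed.

(** In a residue class without crashes, a node from [m * 2 ^ i] up to [m * 2 ^ i.+1] gets the value
    in round [i] from the node [m * 2 ^ i] below it, a member of the same class. *)
Lemma double_reaches i l (v : 'I_n) : (forall w : 'I_n, w %% m = l -> f w = None) ->
  (forall w : 'I_n, w = l :> nat -> sure (c w) != None) -> 0 < m ->
  v %% m = l -> v < m * 2 ^ i -> sure (C i v) != None.
Proof.
move=> correct root m0; elim: i v => [|i IH] v vl hv.
  by apply: root; rewrite -vl modn_small //; rewrite muln1 in hv.
have [hvi|hvi] := ltnP v (m * 2 ^ i).
  have := IH v vl hvi; case E: (sure _) => [b|] // _.
  rewrite run_mkseqS /round_step; case: ifP => _; by rewrite /= ?sure_learn E.
set a := m * 2 ^ i in hvi *.
have un : v - a < n by apply: leq_ltn_trans (leq_subr _ _) (ltn_ord v).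
pose u := Ordinal un; have ua : u + a = v by rewrite /= subnK.
have ul : u %% m = l by rewrite -vl -ua /a mulnC addnC modnMDl.
have ui : u < m * 2 ^ i by rewrite -/a; move: hv; rewrite expnS mulnCA -/a /=; lia.
have := IH u ul ui; case E: (sure (C i u)) => [b|] // _.
have su : (shift a)^-1%g v = u.
  apply: (canLR (permK _)); apply: val_inj; rewrite permE /= subnK //.
  by rewrite modn_small.
rewrite run_mkseqS /round_step completesE correct_alive ?correct //=.
rewrite sure_learn /heard /= -/a su alive_can_send ?correct_alive ?correct //.
by rewrite ui ua ltn_ord E; case: (sure (C i v)).
Qed.

Lemma double_traffic i : 0 < m -> traffic f r (mkseq double_round i) c <= 2 * n.
Proof.
(* Round [k] has at most [m * 2 ^ k] talkers, and none once [m * 2 ^ k >= n], so the geometric sum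
   is at most [2 * n]. *)
move=> m0; suff : traffic f r (mkseq double_round i) c <= minn (m * 2 ^ i) (2 * n) by lia.
elim: i => [//|i IH]; rewrite traffic_mkseqS expnS mulnCA; move: IH.
set a := m * 2 ^ i; set x := traffic _ _ _ _; set y := #|_| => IH.
have ya : y <= if a < n then a else 0.
  case: ltnP => an.
    have inj : injective (widen_ord (ltnW an)).
      by move=> u w /(congr1 val) /= h; apply: val_inj.
    rewrite -[X in _ <= X]card_ord -cardsT -(card_imset _ inj).
    apply: subset_leq_card; apply/subsetP => v; rewrite inE /= => /andP[_].
    case: ifP => // /andP[va _] _; apply/imsetP; exists (Ordinal va) => //.
    exact: val_inj.
  rewrite leqn0 cards_eq0; apply/eqP/setP => v; rewrite !inE /= -/a.
  have -> : v + a < n = false by lia.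
  by rewrite andbF andbF.
by move: ya; case: ltnP => an; lia.
Qed.

End Doubling.

(** * Inquiries and answers *)

Section Pulling.
Variable rho : nat -> {perm 'I_n}.

Definition ask_round j : rnd :=
  Round (rho j) (fun _ s => if sure s is None then Some true else None)
    (fun _ s b => Node (input s) (turn s) (count s) (active s) (sure s) (b != None)).

Definition answer_round j : rnd :=
  Round (rho j)^-1%g (fun _ s => if asked s then sure s else None) (fun _ s b => learn s b).

Definition pull s : seq rnd := flatten (mkseq (fun j => [:: ask_round j; answer_round j]) s).

Lemma size_pull s : size (pull s) = 2 * s.
Proof.
elim: s => [//|s IH]; rewrite /pull mkseqS -cats1 flatten_cat size_cat.
by rewrite -/(pull s) IH /=; lia.
Qed.

Lemma pullS s : pull s.+1 = pull s ++ [:: ask_round s; answer_round s].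
Proof. by rewrite /pull mkseqS -cats1 flatten_cat. Qed.

Section OnePull.
Variables (j r : nat) (c : config).
Let c1 := round_step f r (ask_round j) c.
Let c2 := round_step f r.+1 (answer_round j) c1.

Lemma ask_sure v : sure (c1 v) = sure (c v).
Proof. by rewrite /c1 /round_step; case: ifP. Qed.

Lemma pull1_spreads : spreads c c2.
Proof.
split=> v b; rewrite /c2 /round_step; case: ifP => _ /=; rewrite ?sure_learn ask_sure //.
- by move=> ->.
- case E: (sure (c v)) => [x|]; first by rewrite -E; exists v.
  move/heard_Some => [_ /=]; case: ifP => // _; rewrite ask_sure => h.
  by exists ((rho j)^-1^-1 v)%g.
- by exists v.
Qed.

Lemma pull1_reaches v : alive f r.+2 v -> f (rho j v) = None -> sure (c (rho j v)) != None ->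
  sure (c2 v) != None.
Proof.
move=> av fw sw; rewrite /c2 /round_step completesE av /= sure_learn ask_sure.
case E: (sure (c v)) => //; rewrite /heard /= invgK alive_can_send ?correct_alive //.
rewrite ask_sure; case: ifP => //.
rewrite /c1 /round_step completesE correct_alive //= /heard /= permK.
by rewrite E alive_can_send // (alive_le _ av).
Qed.

(** Only nodes that do not know the value ask, and since [rho j] is injective, each inquiry causes
    at most one answer. A node able to answer has completed the asking round, so its flag [asked] is
    fresh. *)
Lemma pull1_traffic : traffic f r [:: ask_round j; answer_round j] c <= 2 * #|unsure r c|.
Proof.
rewrite /= addn0 mul2n -addnn; set A := talkers _ _ _ _.
have hA : #|A| <= #|unsure r c|.
  apply: subset_leq_card; apply/subsetP => v; rewrite !inE /= => /andP[/can_send_alive ->].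
  by case: sure.
apply: leq_add => //; apply: leq_trans hA.
rewrite -(card_imset _ (@perm_inj _ (rho j))) subset_leq_card //.
apply/subsetP => w; rewrite inE /= => /andP[cw].
case: ifP => // aw _; apply/imsetP; exists ((rho j)^-1 w)%g; last by rewrite permKV.
move: aw; rewrite /round_step completesE (can_send_alive cw) /= /heard /= inE /=.
by case: (can_send _ _ _).
Qed.

End OnePull.

Lemma unsure_spreads r r' c c' : r <= r' -> spreads c c' -> unsure r' c' \subset unsure r c.
Proof.
move=> rr [h _]; apply/subsetP => v; rewrite !inE => /andP[/(alive_le rr) -> /=].
by case E: (sure (c v)) => [b|] //; rewrite (h _ _ E).
Qed.

Lemma unreliable_spreads c c' : spreads c c' -> unreliable c' \subset unreliable c.
Proof.
move=> [h _]; apply/subsetP => v; rewrite !inE; case: eqP => //= _.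
by case E: (sure (c v)) => [b|] //; rewrite (h _ _ E).
Qed.

Lemma pull_spreads s r c : spreads c (run f r (pull s) c).
Proof.
elim: s => [|s IH]; first exact: spreads_refl.
by rewrite pullS run_cat; apply: spreads_trans IH (pull1_spreads _ _ _).
Qed.

Lemma pull_reaches s r c v : v \in unsure (r + 2 * s) (run f r (pull s) c) ->
  forall j, j < s -> rho j v \in unreliable c.
Proof.
elim: s => [//|s IH] hv j; have le : r + 2 * s <= r + 2 * s.+1 by lia.
rewrite pullS run_cat size_pull in hv.
rewrite ltnS leq_eqVlt => /orP[/eqP ->|]; last first.
  by apply: IH; apply: subsetP hv; apply: unsure_spreads => //; apply: pull1_spreads.
have [hs _] := pull_spreads s r c.
move: hv; rewrite !inE => /andP[av]; apply: contraLR.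
rewrite negb_or negbK => /andP[/eqP fw sw].
apply: pull1_reaches => //; first by have -> : (r + 2 * s).+2 = r + 2 * s.+1 by lia.
by case E: (sure (c (rho s v))) sw => [b|] // _; rewrite (hs _ _ E).
Qed.

Lemma pull_traffic s r c : traffic f r (pull s) c <= 2 * s * #|unsure r c|.
Proof.
elim: s => [//|s IH]; rewrite pullS traffic_cat size_pull.
apply: leq_trans (leq_add IH (pull1_traffic _ _ _)) _.
have : #|unsure (r + 2 * s) (run f r (pull s) c)| <= #|unsure r c|.
  by apply: subset_leq_card; apply: unsure_spreads (leq_addr _ _) (pull_spreads _ _ _).
lia.
Qed.

End Pulling.
End Phases.

(** * Probing on an expander *)

Section ExpanderProbing.
Variables (T : finType) (L : {set T}) (e : nat) (sigma : nat -> {perm T}).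
Hypothesis sigmaP : expander L e sigma.
Hypothesis e_large : 64 * expansion <= e.
Local Notation d := (12 * e).

(** * Agreement of the survivors *)

Section Safety.
Variables (A : nat -> {set T}) (value : T -> bool) (g : nat).
Hypothesis AL : A 0 \subset L.
Hypothesis A_anti : forall i, A i.+1 \subset A i.
Hypothesis A_step : forall i v, v \in A i.+1 -> d <= 4 * #|[set j : 'I_d | sigma j v \in A i]|.
Hypothesis value_edge : forall v j, j < d -> v \in A 0 -> sigma j v \in A 0 ->
  value v = value (sigma j v).
Hypothesis g_large : #|L| < 2 ^ g.

Lemma A_sub0 i : A i \subset A 0.
Proof. by elim: i => // i IH; apply: subset_trans (A_anti i) IH. Qed.

Local Notation X b i := [set v in A i | value v == b].

Lemma survivors_double b i : i <= g -> X b g != set0 ->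
  64 * #|X b (g - i)| <= #|L| -> 2 ^ i <= #|X b (g - i)|.
Proof.
move=> + X0; elim: i => [_ _|i IH ig h64]; first by rewrite subn0 card_gt0.
have gi : g - i = (g - i.+1).+1 by lia.
set k := g - i.+1 in gi h64 *; rewrite gi in IH.
have XX : X b k.+1 \subset X b k.
  by apply/subsetP => v; rewrite !inE => /andP[/(subsetP (A_anti k)) -> ->].
have le := subset_leq_card XX.
have {}IH : 2 ^ i <= #|X b k.+1| by apply: IH; lia.
rewrite leqNgt; apply/negP => hlt.
have XL q : X b q \subset L.
  apply/subsetP => v; rewrite inE => /andP[/(subsetP (A_sub0 q)) vA _].
  exact: subsetP AL v vA.
have pos : 0 < 2 ^ i by rewrite expn_gt0.
have [||_ _ h] := sigmaP.2 _ _ (XL k.+1) (XL k); first by lia.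
  by move: hlt; rewrite expnS; nia.
move: (h le h64); apply/negP; rewrite -leqNgt mulnC -sum_nat_const big_distrr /=.
apply: leq_sum => v; rewrite inE => /andP[vA /eqP vb].
apply: leq_trans (A_step vA) _; rewrite leq_mul2l /=; apply: subset_leq_card.
apply/subsetP => j; rewrite !inE => hj; rewrite hj -vb eq_sym /=; apply/eqP.
by apply: value_edge => //; [apply: subsetP (A_sub0 k.+1) v vA | apply: subsetP (A_sub0 k) _ hj].
Qed.

Lemma survivors_many b : X b g != set0 -> #|L| < 64 * #|X b 0|.
Proof.
move=> X0; rewrite ltnNge; apply/negP => h.
have := survivors_double (leqnn g) X0; rewrite subnn => /(_ h).
have : #|X b 0| <= #|L|.
  apply: subset_leq_card; apply/subsetP => v; rewrite inE => /andP[vA _].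
  exact: subsetP AL v vA.
lia.
Qed.

(** Otherwise, by [survivors_many], each of two values is held by more than [#|L| / 64] nodes of
    [A 0]. The first clause of [expander] joins these two sets by an edge, whose ends have the same
    value. *)
Lemma survivors_agree v w : v \in A g -> w \in A g -> value v = value w.
Proof.
move=> vA wA; have ne u : u \in A g -> X (value u) g != set0.
  by move=> uA; apply/set0Pn; exists u; rewrite inE uA eqxx.
case: (value v =P value w) => // /eqP vw; exfalso.
have hU := survivors_many (ne v vA); have hW := survivors_many (ne w wA).
have UL : X (value v) 0 \subset L.
  by apply/subsetP => u; rewrite inE => /andP[/(subsetP AL)].
have WL : X (value w) 0 \subset L.
  by apply/subsetP => u; rewrite inE => /andP[/(subsetP AL)].
have cY : #|L :\: X (value w) 0| = #|L| - #|X (value w) 0| by rewrite cardsD (setIidPr WL).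
have [||h _ _] := sigmaP.2 _ _ UL (subsetDl L (X (value w) 0)); first by lia.
  apply: (@leq_trans (expansion * #|L|)); first by rewrite leq_mul2l cY leq_subr orbT.
  apply: (@leq_trans (64 * expansion * #|X (value v) 0|)); first by rewrite mulnAC; nia.
  by rewrite leq_mul2r e_large orbT.
have [|u uU [j jd]] := h; first by rewrite cY; lia.
rewrite inE negb_and negbK; have uL := subsetP UL u uU.
have -> /= : sigma j u \in L by rewrite perm_closed //; apply: sigmaP.1.
rewrite orbF inE => /andP[sA /eqP sw]; move: uU; rewrite inE => /andP[uA /eqP uv].
by move: vw; rewrite -uv -sw (value_edge jd uA sA) eqxx.
Qed.

End Safety.

(** * The core of nodes that never drop out *)

Variable t : nat.
Hypothesis cardL : #|L| = 5 * t + 1.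

(** [R] is a maximal set of at most [uphalf t] non-faulty nodes with three quarters of their edges
    going to [R] or to faulty nodes. A node of [C] with too few edges into [C] could be added,
    unless [R] has its full size; then [B :|: R] is at most a third of the [5 * t + 1] nodes, and
    the second clause of [expander] is violated. *)
Lemma exists_core (Fs : {set T}) : #|Fs| <= t -> exists R : {set T}, 2 * #|R| <= t + 1 /\
  let C := L :\: Fs :\: R in
  (#|R| <= t) /\ forall v, v \in C -> d <= 4 * #|[set j : 'I_d | sigma j v \in C]|.
Proof.
move=> Ft; set B := L :&: Fs; set G := L :\: Fs.
have e0 : 0 < e by apply: leq_trans e_large; rewrite muln_gt0 expansion_gt0.
pose P (R : {set T}) := [&& R \subset G, #|R| <= uphalf t &
  3 * (d * #|R|) <= 4 * \sum_(v in R) #|[set j : 'I_d | sigma j v \in B :|: R]|].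
have P0 : P set0 by rewrite /P sub0set cards0 big_set0 !muln0.
have [R /maxsetP[/and3P[RG Rt hR] Rmax] _] := maxset_exists P0.
have up : 2 * uphalf t <= t + 1 by lia.
exists R; split; first by lia.
split=> [|v vC]; first by lia.
rewrite leqNgt; apply/negP => hv.
have vG : v \in G by move: vC; rewrite inE => /andP[].
have vR : v \notin R by move: vC; rewrite inE => /andP[].
have vL : v \in L by move: vG; rewrite inE => /andP[].
have many : 3 * d < 4 * #|[set j : 'I_d | sigma j v \in B :|: R]|.
  have h : #|[set j : 'I_d | sigma j v \in G :\: R]| + #|[set j : 'I_d | sigma j v \in B :|: R]| = d.
    rewrite -[RHS]card_ord -cardsT -(cardsID [set j : 'I_d | sigma j v \in G :\: R] setT) setTI setTD.
    congr (_ + _); apply: eq_card => j; rewrite !inE.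
    have -> : sigma j v \in L by rewrite perm_closed //; apply: sigmaP.1.
    by rewrite /= andbT negb_and !negbK orbC.
  lia.
have [small|big] := ltnP #|R| (uphalf t).
  have PR' : P (v |: R).
    apply/and3P; split.
    - by rewrite subUset sub1set vG.
    - by rewrite cardsU1 vR.
    - rewrite cardsU1 vR (big_setU1 _ vR) /= mulnDr mulnDr [X in _ <= X]mulnDr leq_add //.
        rewrite muln1; apply: leq_trans (ltnW many) _; rewrite leq_mul2l /=; apply/subset_leq_card.
        by apply/subsetP => j; rewrite !inE => /orP[] ->; rewrite ?orbT.
      apply: leq_trans hR _; rewrite leq_mul2l /=; apply: leq_sum => w _.
      by apply/subset_leq_card/subsetP => j; rewrite !inE => /orP[] ->; rewrite ?orbT.
  have := Rmax _ PR' (subsetUr _ _) => e1.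
  by move: vR; rewrite -e1 setU11.
have BG : #|B| <= t by apply: leq_trans Ft; rewrite subset_leq_card ?subsetIr.
have cBR : #|B :|: R| <= t + #|R|.
  by apply: leq_trans (leq_card_setU _ _) _; rewrite leq_add2r.
(* For [t = 0] the set [R] is empty and [expander] does not apply to it; but then [B :|: R] is empty
   as well. *)
have [t0|t0] := posnP t.
  have : #|[set j : 'I_d | sigma j v \in B :|: R]| = 0.
    apply/eqP; rewrite cards_eq0; apply/eqP/setP => j; rewrite [RHS]inE.
    have -> : B :|: R = set0 by apply/eqP; rewrite -cards_eq0 -leqn0; move: cBR Rt; rewrite t0 /=; lia.
    by rewrite !inE.
  by move=> h0; rewrite h0 in many.
have RL : R \subset L by apply: subset_trans RG (subsetDl _ _).
have BRL : B :|: R \subset L by rewrite subUset subsetIl RL.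
have [||_ h _] := sigmaP.2 _ _ RL BRL; first by lia.
  apply: (@leq_trans (64 * expansion * #|R|)); last by rewrite leq_mul2r e_large orbT.
  by rewrite [64 * _]mulnC -mulnA leq_mul2l; apply/orP; right; lia.
have : 4 * \sum_(v in R) #|[set j : 'I_d | sigma j v \in B :|: R]| < 3 * (d * #|R|).
  by apply: h; [rewrite subset_leq_card // subsetUr | rewrite cardL; lia].
by rewrite ltnNge hR.
Qed.

End ExpanderProbing.

(** * The consensus algorithm *)

Lemma flatten_nseqS (T : Type) k (s : seq T) :
  flatten (nseq k.+1 s) = flatten (nseq k s) ++ s.
Proof. by elim: k => [|k IH] /=; rewrite ?cats0 // -catA -IH. Qed.

Lemma size_flatten_nseq (T : Type) k (s : seq T) : size (flatten (nseq k s)) = k * size s.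
Proof. by elim: k => //= k IH; rewrite size_cat IH mulSn. Qed.

(** With this many inquiries, [pull_block] leaves at most half as many unsure nodes as there were
    unreliable ones. *)
Definition halving := 2 * expansion.

(** * Stages of inquiries *)

Section PullStages.
Variables (n : nat) (f : crash_schedule n) (t N : nat) (rho : nat -> {perm 'I_n}).
Hypothesis fb : crash_bounded f t.
Hypothesis rhoP : prefix_expander N rho.
Implicit Type c : 'I_n -> node.

Lemma halving_gt0 : 0 < halving. Proof. by rewrite muln_gt0 expansion_gt0. Qed.

(** With more unsure nodes left, [prefix_expander] would provide one of them that had asked a
    reliable node. *)
Lemma pull_block s r c : 0 < s <= N -> 64 * #|unreliable f c| <= 63 * n ->
  s * #|unsure f (r + 2 * s) (run f r (pull rho s) c)| <= expansion * #|unreliable f c|.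
Proof.
move=> hs h64; rewrite leqNgt; apply/negP => hlt.
have u0 : 0 < #|unsure f (r + 2 * s) (run f r (pull rho s) c)|.
  by move: hlt; case: #|unsure _ _ _| => //; rewrite muln0.
have [|v vU [j js]] := @rhoP _ _ _ u0 hs _ (ltnW hlt); first by rewrite card_ord.
by rewrite (pull_reaches vU js).
Qed.

Lemma unsure_unreliable r c : #|unsure f r c| <= #|unreliable f c|.
Proof.
by apply: subset_leq_card; apply/subsetP => v; rewrite !inE => /andP[_ ->]; rewrite orbT.
Qed.

Lemma unreliable_bound r c : #|unreliable f c| <= #|unsure f r c| + t.
Proof.
apply: leq_trans (leq_add (leqnn _) fb); apply: leq_trans (leq_card_setU _ _).
apply: subset_leq_card; apply/subsetP => v; rewrite !inE.
case fv: (f v) => [q|] /=; first by rewrite orbT.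
by rewrite correct_alive // => ->.
Qed.

(** A block turns [a + 2 * t] into at most [(a + 2 * t) / 2 + t], the last [t] accounting for the
    crashing nodes; so it is the excess over [2 * t] that halves. The traffic is a geometric sum
    plus [O(t)] for each block. *)
Lemma pull_halves p r c a : halving <= N -> 64 * #|unreliable f c| <= 63 * n ->
  #|unreliable f c| <= a + 2 * t ->
  let prog := flatten (nseq p (pull rho halving)) in
  let c' := run f r prog c in
  [/\ spreads c c', #|unreliable f c'| <= a %/ 2 ^ p + 2 * t
    & traffic f r prog c <= 2 * halving * (2 * a + 2 * t * p)].
Proof.
move=> hN; elim: p r c a => [|p IH] r c a h64 ha /=.
  by split=> //; [apply: spreads_refl | rewrite divn1].
set q := pull rho halving; set c1 := run f r q c.
have sp : spreads c c1 := pull_spreads _ _ _ _ _.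
have sub : #|unreliable f c1| <= #|unreliable f c|.
  exact/subset_leq_card/unreliable_spreads.
have h1 : #|unreliable f c1| <= a %/ 2 + 2 * t.
  have := @pull_block halving r c; rewrite hN halving_gt0 => /(_ isT h64).
  rewrite /halving mulnAC [X in _ <= X]mulnC => h.
  have {}h : 2 * #|unsure f (r + 2 * halving) c1| <= #|unreliable f c|.
    by move: h; rewrite leq_pmul2r ?expansion_gt0.
  by have := unreliable_bound (r + 2 * halving) c1; lia.
have [|sp' h2 h3] := IH (r + size q) c1 (a %/ 2) _ h1.
  by apply: leq_trans h64; rewrite leq_mul2l.
rewrite run_cat traffic_cat -/c1; split.
- exact: spreads_trans sp sp'.
- by move: h2; rewrite -divnMA -expnS.
have h4 : traffic f r q c <= 2 * halving * (a + 2 * t).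
  apply: leq_trans (pull_traffic _ _ _ _ _) _; rewrite leq_mul2l; apply/orP; right.
  by apply: leq_trans (unsure_unreliable _ _) ha.
apply: leq_trans (leq_add h4 h3) _; rewrite -mulnDr leq_mul2l; apply/orP; right.
by have := leq_divM a 2; lia.
Qed.

Lemma size_pulls k : size (flatten (mkseq (fun i => pull rho (halving * 2 ^ i)) k)) =
  2 * halving * (2 ^ k).-1.
Proof.
elim: k => [|k IH]; first by rewrite muln0.
rewrite mkseqS -cats1 flatten_cat size_cat IH /= cats0 size_pull mulnA -mulnDr expnS.
have : 0 < 2 ^ k by rewrite expn_gt0.
by move=> h; congr (_ * _); lia.
Qed.

(** Stage [i] doubles the inquiries per node, but at most [2 * t / 2 ^ i] nodes are left to make
    them, so each stage costs [O(t)] messages, while all stages together take [O(2 ^ k)] rounds. *)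
Lemma pull_finishes k r c : halving * 2 ^ k <= N -> 64 * #|unreliable f c| <= 63 * n ->
  #|unreliable f c| <= 2 * t ->
  let prog := flatten (mkseq (fun i => pull rho (halving * 2 ^ i)) k.+1) in
  let c' := run f r prog c in
  [/\ spreads c c', 2 ^ k * #|unsure f (r + size prog) c'| <= t
    & traffic f r prog c <= 4 * halving * t * k.+1].
Proof.
move=> hN h64 ht /=.
have step i r' c1 : i <= k -> spreads c c1 ->
    2 ^ i * #|unsure f (r' + 2 * (halving * 2 ^ i)) (run f r' (pull rho (halving * 2 ^ i)) c1)| <= t.
  move=> ik sp.
  have sub : #|unreliable f c1| <= #|unreliable f c|.
    exact/subset_leq_card/unreliable_spreads.
  have := @pull_block (halving * 2 ^ i) r' c1.
  rewrite muln_gt0 halving_gt0 expn_gt0 /= => h.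
  have {}h : halving * 2 ^ i * #|unsure f (r' + 2 * (halving * 2 ^ i))
      (run f r' (pull rho (halving * 2 ^ i)) c1)| <= expansion * (2 * t).
    apply: leq_trans (h _ _) _.
    - by apply: leq_trans hN; rewrite leq_mul2l leq_exp2l // ik orbT.
    - by apply: leq_trans h64; rewrite leq_mul2l.
    - by rewrite leq_mul2l (leq_trans sub ht) orbT.
  by move: h; rewrite -mulnA [expansion * _]mulnCA [2 * (expansion * _)]mulnA leq_pmul2l ?halving_gt0.
suff H i : i <= k.+1 -> let prog := flatten (mkseq (fun i => pull rho (halving * 2 ^ i)) i) in
  let c' := run f r prog c in
  [/\ spreads c c', 2 ^ i * #|unsure f (r + size prog) c'| <= 2 * t
    & traffic f r prog c <= 4 * halving * t * i].
  have [h1 h2 h3] := H k.+1 (leqnn _); split=> //.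
  by move: h2; rewrite expnS -mulnA leq_pmul2l.
elim: i => [_|i IH ik]; cbv zeta.
  split=> //; first exact: spreads_refl.
  by rewrite expn0 mul1n; apply: leq_trans (unsure_unreliable _ _) ht.
have [h1 h2 h3] := IH (ltnW ik).
rewrite mkseqS -cats1 flatten_cat /= cats0 run_cat traffic_cat size_cat addnA size_pull.
set q := flatten _ in h1 h2 h3 *; set c1 := run f r q c in h1 h2 h3 *.
split.
- exact: spreads_trans h1 (pull_spreads _ _ _ _ _).
- by rewrite expnS -mulnA leq_pmul2l // step.
rewrite mulnSr; apply: leq_add => //; apply: leq_trans (pull_traffic _ _ _ _ _) _.
move: h2; move: (#|unsure _ _ _|) (2 ^ i) => A B h2.
have := leq_mul (leqnn (2 * halving)) h2; lia.
Qed.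

End PullStages.

Definition degree := 12 * (64 * expansion).

Definition initial n t (v : 'I_n) (b : bool) : node :=
  Node b (if (v < 5 * t + 1) && b then Some 0 else None) 0 (v < 5 * t + 1) None false.

(** [2 ^ final_pulls t] exceeds [t], so the last stage leaves less than one unsure node. *)
Definition final_pulls t := (trunc_log 2 t).+1.

Definition agreement_part n t (sigma : nat -> {perm 'I_n}) : seq (round n node) :=
  flood sigma degree (5 * t + 1) ++
  flatten (nseq (trunc_log 2 (5 * t + 1)).+1 (probe sigma degree)) ++ [:: commit_round n].

Definition spreading_part n t (rho : nat -> {perm 'I_n}) : seq (round n node) :=
  mkseq (double_round n (5 * t + 1)) (trunc_log 2 n).+1 ++
  flatten (nseq (trunc_log 2 n).+1 (pull rho halving)) ++
  flatten (mkseq (fun i => pull rho (halving * 2 ^ i)) (final_pulls t).+1).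

Definition decide (s : node) : bool := odflt (input s) (sure s).

(** * Correctness of the composed program *)

Section Correctness.
Variables (n t : nat) (sigma rho : nat -> {perm 'I_n}).
Local Notation m := (5 * t + 1).
Local Notation d := degree.
Local Notation D := (2 * degree).
Local Notation g := (trunc_log 2 m).+1.
Local Notation l := (trunc_log 2 n).
Let L : {set 'I_n} := [set v : 'I_n | v < m].
Hypothesis tn : 5 * t < n.
Hypothesis sigmaP : expander L (64 * expansion) sigma.
Hypothesis rhoP : prefix_expander (halving * 2 ^ final_pulls t) rho.
Variables (x : 'I_n -> bool) (f : crash_schedule n).
Hypothesis fb : crash_bounded f t.

Lemma m_le_n : m <= n. Proof. by rewrite addn1. Qed.

Lemma card_L : #|L| = m.
Proof.
rewrite -sum1_card; under eq_bigl do rewrite inE.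
by rewrite -(big_ord_widen n (fun=> 1) m_le_n) sum1_card card_ord.
Qed.

Lemma degree_gt0 : 0 < d. Proof. by rewrite !muln_gt0 expansion_gt0. Qed.

Let c0 : 'I_n -> node := fun v => initial t v (x v).
Let c1 := run f 0 (flood sigma d m) c0.
Let T1 := D * m.
Let c2 i := run f T1 (flatten (nseq i (probe sigma d))) c1.
Let A i := [set v | alive f (T1 + i * d) v && active (c2 i v)].
Let value v := turn (c1 v) != None.

Lemma turn_c0 v a : turn (c0 v) = Some a -> a = 0 /\ v \in L.
Proof. by rewrite /= inE; case: ltnP => //=; case: (x v) => // _ [<-]. Qed.

Lemma active_c1 v : active (c1 v) = (v < m).
Proof.
by have [_ -> _] := @flood_same n f sigma d 0 c0 (D * m) v.
Qed.

Lemma c2S i : c2 i.+1 = run f (T1 + i * d) (probe sigma d) (c2 i).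
Proof. by rewrite /c2 flatten_nseqS run_cat size_flatten_nseq size_mkseq. Qed.

Lemma c2_same i v : turn (c2 i v) = turn (c1 v) /\ sure (c2 i v) = None.
Proof.
elim: i => [|i [h1 h2]].
  by split=> //; have [_ _ ->] := @flood_same n f sigma d 0 c0 (D * m) v.
by rewrite c2S; have [-> -> _ _] := @probe_spec n f sigma d (T1 + i * d) (c2 i) degree_gt0 v.
Qed.

Lemma c2_active_L i v : active (c2 i v) -> v \in L.
Proof.
elim: i => [|i IH]; first by rewrite /c2 /= active_c1 inE.
by rewrite c2S => /(@probe_antimono n f sigma d _ _ degree_gt0).
Qed.

Lemma A_agree v w : v \in A g -> w \in A g -> value v = value w.
Proof.
apply: (survivors_agree sigmaP (leqnn _)).
- by apply/subsetP => u; rewrite inE => /andP[_]; apply: c2_active_L.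
- move=> i; apply/subsetP => u; rewrite !inE c2S => /andP[au /(@probe_antimono n f sigma d _ _ degree_gt0) ->].
  by rewrite andbT (alive_le _ au) // leq_add2l leq_mul2r leqnSn orbT.
- move=> i u; rewrite inE c2S mulSn [d + _]addnC addnA => /andP[au su].
  have [_] := probe_sound degree_gt0 au su.
  set X := [set j | _]; set Y := [set j | _]; have -> : X = Y by apply/setP => j; rewrite !inE.
  by [].
- move=> u j jd; rewrite !inE => /andP[au _] /andP[aj _].
  rewrite mul0n addn0 in au aj.
  by apply: (flood_uniform (r0 := 0) sigmaP.1 turn_c0 card_L degree_gt0 jd).
- by rewrite card_L; apply: trunc_log_ltn.
Qed.

(** The core nodes do not crash and keep responding to each other, so by induction none of them
    drops out. *)
Lemma core_active : exists R : {set 'I_n}, [/\ 2 * #|R| <= t + 1, #|R| <= t &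
  forall i v, v \in L -> f v = None -> v \notin R -> active (c2 i v)].
Proof.
have [R [h1 [h2 hC]]] := exists_core sigmaP (leqnn _) card_L fb.
exists R; split=> // i v vL fv vR.
set C := L :\: _ :\: R in hC.
have {vL fv vR} vC : v \in C by rewrite !inE vR fv eqxx; rewrite inE in vL.
elim: i v vC => [|i IH] v vC.
  by rewrite /c2 /= active_c1; move: vC; rewrite !inE => /and3P[].
rewrite c2S; apply: probe_complete (IH _ vC) _; rewrite ?degree_gt0 //.
apply: leq_trans (hC v vC) _; rewrite leq_mul2l /=; apply: subset_leq_card.
apply/subsetP => j; rewrite inE => jC; rewrite inE IH // andbT.
by apply: correct_alive; move: jC; rewrite !inE negbK => /and3P[_ /eqP].
Qed.

Let T2 := T1 + g * d.
Let c3 := round_step f T2 (commit_round n) (c2 g).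

Lemma sure_c3 v b : sure (c3 v) = Some b -> v \in A g /\ b = value v.
Proof.
rewrite /c3 /round_step; have [e1 e2] := c2_same g v.
case: ifP => [|_]; last by rewrite e2.
rewrite completesE => av /=; case ac: (active _) => // -[<-]; rewrite e1; split=> //.
by rewrite inE ac andbT; apply: alive_le av.
Qed.

Lemma c3_sure v : f v = None -> active (c2 g v) -> sure (c3 v) = Some (value v).
Proof.
move=> fv ac; rewrite /c3 /round_step completesE correct_alive //= ac.
by have [-> _] := c2_same g v.
Qed.

(** A turn goes back to an input 1. Without a turn, the input of [v] itself is 0, as the nodes of
    [L] with input 1 start with a turn. *)
Lemma value_valid v : v \in L -> exists w, x w = value v.
Proof.
move=> vL; rewrite /value; case E: (turn (c1 v) != None).
  have [w] := flood_origin E; rewrite /=; case: ifP => // /andP[_ xw] _.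
  by exists w.
exists v; apply: contraFF E => xv; apply: flood_keeps.
by rewrite /= xv; rewrite inE in vL; rewrite vL.
Qed.

Lemma c3_agreement : exists b, (exists w, x w = b) /\ forall v y, sure (c3 v) = Some y -> y = b.
Proof.
have [R [h1 h2 hR]] := core_active.
(* The core is nonempty since [5 * t + 1] exceeds [t + #|R|]; the value of one of its nodes is the
   common one. *)
have [v0] : exists v, v \in L :\: [set v | f v != None] :\: R.
  apply/set0Pn; rewrite -card_gt0 !cardsD.
  have i1 : #|L :&: [set v | f v != None]| <= t.
    by apply: leq_trans fb; rewrite subset_leq_card // subsetIr.
  have i2 : #|(L :\: [set v | f v != None]) :&: R| <= #|R| by rewrite subset_leq_card // subsetIr.
  by have := card_L; lia.
rewrite !inE negbK => /and3P[vR /eqP fv vL].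
have vL' : v0 \in L by rewrite inE.
have vA : v0 \in A g by rewrite inE correct_alive // hR.
exists (value v0); split; first exact: value_valid.
by move=> v y /sure_c3[/A_agree h ->]; apply: h.
Qed.

Let c4 := run f T2.+1 (mkseq (double_round n m) l.+1) c3.

(** A residue class is good if no node in it crashes and its member of [L] is outside [R]. At least
    two thirds of the classes are good, each has at least [n %/ m] members, and
    [n < 2 * m * (n %/ m)]; so at least a third of all nodes are reliable. *)
Lemma c4_unreliable : 64 * #|unreliable f c4| <= 63 * n.
Proof.
have [R [h1 h2 hR]] := core_active.
have m0 : 0 < m by rewrite addn1.
have rp (w : 'I_n) : w %% m < n by apply: leq_trans (ltn_pmod _ m0) m_le_n.
pose res (w : 'I_n) : 'I_n := Ordinal (rp w).
pose G := L :\: (R :|: [set res w | w in [set v | f v != None]]).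
have cG : 2 * m <= 3 * #|G|.
  have : #|R :|: [set res w | w in [set v | f v != None]]| <= #|R| + t.
    apply: leq_trans (leq_card_setU _ _) _; rewrite leq_add2l.
    exact: leq_trans (leq_imset_card _ _) fb.
  have : #|L :&: (R :|: [set res w | w in [set v | f v != None]])| <=
     #|R :|: [set res w | w in [set v | f v != None]]| by rewrite subset_leq_card // subsetIr.
  rewrite /G cardsD card_L; lia.
have good w : res w \in G -> f w = None /\ sure (c4 w) != None.
  move=> wG; have fr (u : 'I_n) : u %% m = w %% m -> f u = None.
    move=> e; apply/eqP; apply: contraTT wG => fu.
    have -> : res w = res u by apply: val_inj.
    by rewrite !inE imset_f ?orbT ?inE.
  split; first exact: fr.
  apply: (@double_reaches n f m T2.+1 c3 _ (w %% m)) => //.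
    move=> u ul; have eu : u = res w by apply: val_inj.
    move: wG; rewrite -eu !inE negb_or => /andP[/andP[uR _] um].
    have fu : f u = None by apply: fr; rewrite ul modn_mod.
    by rewrite c3_sure // hR // inE.
  apply: leq_trans (ltn_ord w) _; apply: leq_trans (ltnW (trunc_log_ltn n (isT : 1 < 2))) _.
  by rewrite leq_pmull.
(* The [minn] keeps [put] inside ['I_n] for arbitrary [q]; [putE] removes it when [q.1] is in
   [G]. *)
have lt (q : 'I_n * 'I_(n %/ m)) : minn (q.1 %% m + m * q.2) n.-1 < n by lia.
pose put (q : 'I_n * 'I_(n %/ m)) : 'I_n := Ordinal (lt q).
have putE q : q.1 \in G -> put q = q.1 + m * q.2 :> nat.
  rewrite !inE => /andP[_ q1]; rewrite /= modn_small //.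
  apply/minn_idPl; have : m * q.2.+1 <= n.
    by apply: leq_trans (leq_divM n m); rewrite mulnC leq_mul2r ltn_ord orbT.
  rewrite mulnS => h; rewrite -ltnS prednK ?(leq_ltn_trans (leq0n _) tn) //.
  by apply: leq_trans h; rewrite ltn_add2r.
have putG q : q.1 \in G -> res (put q) = q.1.
  move=> qG; apply: val_inj; change (put q %% m = q.1 :> nat).
  rewrite putE // [X in (_ + X) %% _]mulnC [X in X %% _]addnC modnMDl modn_small //.
  by move: qG; rewrite !inE => /andP[].
have cput : #|G| * (n %/ m) <= #|~: unreliable f c4|.
  have -> : #|G| * (n %/ m) = #|setX G [set: 'I_(n %/ m)]| by rewrite cardsX cardsT card_ord.
  rewrite -(card_in_imset (f := put)).
    apply: subset_leq_card; apply/subsetP => w /imsetP[q]; rewrite inE => /andP[qG _] ->.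
    have [] := good (put q); first by rewrite putG.
    by move=> fw sw; rewrite !inE fw negb_or sw.
  move=> [a1 b1] [a2 b2] /setXP[qG1 _] /setXP[qG2 _] eq.
  have e1 : a1 = a2 by have := putG (a1, b1) qG1; rewrite eq (putG (a2, b2) qG2).
  have /eqP := congr1 (fun v : 'I_n => v : nat) eq.
  rewrite (putE (a1, b1) qG1) (putE (a2, b2) qG2) e1 eqn_add2l eqn_pmul2l //= => /eqP e2.
  by congr (_, _); apply: val_inj.
have := cardsC (unreliable f c4); rewrite card_ord.
have := divn_eq n m; have := ltn_pmod n m0.
have : 0 < n %/ m by rewrite divn_gt0 // m_le_n.
move: cG cput; move: (#|G|) (n %/ m) (n %% m) (#|unreliable f c4|) (#|~: _|).
move: (5 * t + 1) => M a b r u w h3 h4 b0 hr hn huw.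
have : 2 * M * b <= 3 * a * b by rewrite leq_mul2r h3 orbT.
nia.
Qed.

Let T4 := T2.+1 + l.+1.
Let q1 := flatten (nseq l.+1 (pull rho halving)).
Let c5 := run f T4 q1 c4.
Let q2 := flatten (mkseq (fun i => pull rho (halving * 2 ^ i)) (final_pulls t).+1).
Let c6 := run f (T4 + size q1) q2 c5.

Lemma c5_spec : [/\ spreads c4 c5, #|unreliable f c5| <= 2 * t
  & traffic f T4 q1 c4 <= 2 * halving * (2 * n + 2 * t * l.+1)].
Proof.
have hN : halving <= halving * 2 ^ final_pulls t by rewrite leq_pmulr // expn_gt0.
have [|h1 h2 h3] := pull_halves fb rhoP l.+1 T4 (a := n) hN c4_unreliable.
  by apply: leq_trans (max_card _) _; rewrite card_ord leq_addr.
split=> //; apply: leq_trans h2 _.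
by rewrite divn_small // trunc_log_ltn.
Qed.

Lemma c6_spec : [/\ spreads c5 c6, unsure f (T4 + size q1 + size q2) c6 = set0
  & traffic f (T4 + size q1) q2 c5 <= 4 * halving * t * (final_pulls t).+1].
Proof.
have [s5 u5 _] := c5_spec.
have h64 : 64 * #|unreliable f c5| <= 63 * n.
  by apply: leq_trans c4_unreliable; rewrite leq_mul2l /=; apply/subset_leq_card/unreliable_spreads.
have [h1 h2 h3] := pull_finishes rhoP (T4 + size q1) (leqnn _) h64 u5.
split=> //; apply/eqP; rewrite -cards_eq0 -leqn0 -ltnS.
have pos : 0 < 2 ^ final_pulls t by rewrite expn_gt0.
rewrite -(ltn_pmul2l pos); apply: leq_ltn_trans h2 _; rewrite muln1.
exact: trunc_log_ltn.
Qed.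

Let prog := agreement_part t sigma ++ spreading_part t rho.

Lemma size_agreement : size (agreement_part t sigma) = T2.+1.
Proof.
rewrite /agreement_part !size_cat size_mkseq size_flatten_nseq size_mkseq addnA.
exact: addn1.
Qed.

Lemma size_prog : size prog = T4 + size q1 + size q2.
Proof. by rewrite /prog size_cat size_agreement /spreading_part !size_cat size_mkseq !addnA. Qed.

Lemma run_agreement : run f 0 (agreement_part t sigma) c0 = c3.
Proof.
rewrite /agreement_part run_cat run_cat add0n.
by rewrite [size (flatten _)]size_flatten_nseq !size_mkseq.
Qed.

Lemma run_prog : run f 0 prog c0 = c6.
Proof.
by rewrite /prog run_cat run_agreement size_agreement add0n /spreading_part run_cat run_cat size_mkseq.
Qed.

Lemma prog_decides : exists b, (exists w, x w = b) /\
  forall v, alive f (size prog) v -> decide (run f 0 prog c0 v) = b.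
Proof.
have [b [hw hb]] := c3_agreement; exists b; split=> // v.
rewrite size_prog run_prog => av; have [_ s45] : spreads c3 c6; last first.
  have [_ u6 _] := c6_spec; have : v \notin unsure f (T4 + size q1 + size q2) c6 by rewrite u6 inE.
  rewrite inE av /= /decide; case E: (sure _) => [y|] // _ /=.
  by have [w /hb] := s45 _ _ E.
have [s5 _ _] := c5_spec; have [s6 _ _] := c6_spec.
exact: spreads_trans (spreads_trans (double_spreads _ _ _ _ _) s5) s6.
Qed.

Lemma probes_traffic i : traffic f T1 (flatten (nseq i (probe sigma d))) c1 <= i * (d * m).
Proof.
elim: i => [//|i IH]; rewrite flatten_nseqS traffic_cat mulSn addnC leq_add //.
rewrite size_flatten_nseq size_mkseq -card_L; apply: probe_traffic => v.
exact: c2_active_L.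
Qed.

Lemma agreement_traffic : traffic f 0 (agreement_part t sigma) c0 <= D * m + g * (d * m).
Proof.
rewrite /agreement_part traffic_cat traffic_cat add0n size_mkseq.
apply: leq_add; first exact: flood_traffic sigmaP.1 turn_c0 card_L.
rewrite [X in _ + X](_ : _ = 0) ?addn0 ?probes_traffic //=.
by rewrite addn0; apply/eqP; rewrite cards_eq0; apply/eqP/setP => v; rewrite !inE andbF.
Qed.

Lemma spreading_traffic : traffic f T2.+1 (spreading_part t rho) c3 <=
  2 * n + 2 * halving * (2 * n + 2 * t * l.+1) + 4 * halving * t * (final_pulls t).+1.
Proof.
have [_ _ h5] := c5_spec; have [_ _ h6] := c6_spec.
rewrite /spreading_part traffic_cat traffic_cat size_mkseq addnA.
apply: leq_add h6; apply: leq_add h5; apply: double_traffic.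
by rewrite addn1.
Qed.

Lemma prog_traffic : traffic f 0 prog c0 <=
  D * m + g * (d * m) + (2 * n + 2 * halving * (2 * n + 2 * t * l.+1)
  + 4 * halving * t * (final_pulls t).+1).
Proof.
rewrite /prog traffic_cat run_agreement size_agreement.
exact: leq_add agreement_traffic spreading_traffic.
Qed.

End Correctness.

(** * Explicit bounds and the resulting protocol *)

Lemma halving_degree : 0 < halving <= degree.
Proof. by have := expansion_gt0; rewrite /halving /degree; lia. Qed.

Lemma trunc_log_bounds n t : 5 * t < n -> 1 < n ->
  [/\ 0 < trunc_log 2 n <= n, trunc_log 2 (5 * t + 1) <= trunc_log 2 n,
      trunc_log 2 t <= trunc_log 2 n & 2 ^ (final_pulls t).+1 <= 4 * t.+1].
Proof.
move=> tn n1; split.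
- rewrite trunc_log_gt0 n1 /=; have := trunc_logP (isT : 1 < 2) (ltnW n1).
  by apply: leq_trans; apply/ltnW/ltn_expl.
- by apply: leq_trunc_log; lia.
- by apply: leq_trunc_log; lia.
rewrite /final_pulls !expnS mulnA leq_mul2l /=; have [->//|t0] := posnP t.
by apply: leq_trans (trunc_logP _ t0) _.
Qed.

Lemma program_size_bound n t (sigma rho : nat -> {perm 'I_n}) : 5 * t < n -> 1 < n ->
  size (agreement_part t sigma ++ spreading_part t rho) <=
  100 * degree * (t + trunc_log 2 n).
Proof.
move=> tn n1; have [/andP[l0 _] gl _ fp] := trunc_log_bounds tn n1.
have /andP[h0 hd] := halving_degree.
rewrite size_prog size_flatten_nseq size_pull size_pulls.
move: (trunc_log 2 (5 * t + 1)) (trunc_log 2 n) (2 ^ _) halving degree gl l0 fp h0 hd.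
move=> g l p h d gl l0 fp h0 hd.
have e1 : g.+1 * d <= l.+1 * d by rewrite leq_mul2r ltnS gl orbT.
have e2 : l.+1 * (2 * h) <= l.+1 * (2 * d) by rewrite !leq_mul2l hd !orbT.
have e3 : 2 * h * p.-1 <= 2 * d * (4 * t.+1).
  by apply: leq_mul; [rewrite leq_mul2l hd orbT | apply: leq_trans (leq_pred _) fp].
have e4 : l.+1 <= l.+1 * d by rewrite leq_pmulr //; lia.
have e5 : d <= d * l by rewrite leq_pmulr.
by nia.
Qed.

Lemma program_traffic_bound n t : 5 * t < n -> 1 < n ->
  2 * degree * (5 * t + 1) + (trunc_log 2 (5 * t + 1)).+1 * (degree * (5 * t + 1)) +
  (2 * n + 2 * halving * (2 * n + 2 * t * (trunc_log 2 n).+1)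
   + 4 * halving * t * (final_pulls t).+1) <= 100 * degree * (n + t * trunc_log 2 n).
Proof.
move=> tn n1; have [/andP[l0 ln] gl tl _] := trunc_log_bounds tn n1.
have /andP[h0 hd] := halving_degree; rewrite /final_pulls.
move: (trunc_log 2 (5 * t + 1)) (trunc_log 2 n) (trunc_log 2 t) halving degree gl l0 ln tl h0 hd.
move=> g l k h d gl l0 ln tl h0 hd.
have e1 : g.+1 * (d * (5 * t + 1)) <= l.+1 * (d * (5 * t + 1)) by rewrite leq_mul2r ltnS gl orbT.
have e2 : 2 * h * (2 * n + 2 * t * l.+1) <= 2 * d * (2 * n + 2 * t * l.+1).
  by rewrite leq_mul2r leq_mul2l hd !orbT.
have e3 : 4 * h * t * k.+2 <= 4 * d * t * l.+2.
  by apply: leq_mul => //; rewrite leq_mul2r leq_mul2l hd !orbT.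
have e4 : 2 * n <= 2 * (d * n) by rewrite leq_mul2l leq_pmull ?orbT //; lia.
have e5 : d * t <= d * n by rewrite leq_mul2l; apply/orP; right; lia.
have e6 : d * l <= d * n by rewrite leq_mul2l ln orbT.
have e7 : d <= d * n by rewrite leq_pmulr //; lia.
by nia.
Qed.

Lemma consensus_protocol_exists n t : exists P : protocol n, 5 * t < n ->
  [/\ solves_consensus P t,
      runs_within P t (100 * degree * (t + trunc_log 2 n))
    & sends_within P t (100 * degree * (n + t * trunc_log 2 n))].
Proof.
case tn: (5 * t < n); last by exists (program_protocol [::] (@initial n t) decide).
(* For [n = 1] both [t] and the logarithm vanish, so the node must halt at once: it decides its
   input after zero rounds. *)
have [n1|n1] := leqP n 1.
  exists (program_protocol [::] (@initial n t) decide) => _.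
  have [|h1 h2 h3] := @program_correct n node [::] (@initial n t) decide t 0.
    move=> x f _; split=> //; have n0 : 0 < n by lia.
    exists (x (Ordinal n0)); split; first by exists (Ordinal n0).
    move=> v _ /=; rewrite /decide /=; congr x; apply: val_inj => /=.
    by have := ltn_ord v; lia.
  split=> // x f hf; last by move=> R; apply: leq_trans (h3 x f hf R) _.
  by have [T hT ha] := h2 x f hf; exists T => //; apply: leq_trans hT _.
pose L := [set v : 'I_n | v < 5 * t + 1].
have L0 : 0 < #|L| by rewrite /L card_L // addn1.
have e0 : 0 < 64 * expansion by rewrite muln_gt0 expansion_gt0.
have [sigma sigmaP] := exists_expander L0 e0.
have T0 : 0 < #|'I_n| by rewrite card_ord; lia.
have [rho rhoP] := exists_prefix_expander (halving * 2 ^ final_pulls t) T0.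
pose p := agreement_part t sigma ++ spreading_part t rho.
exists (program_protocol p (@initial n t) decide) => _.
have [|h1 h2 h3] := @program_correct n node p (@initial n t) decide t
    (100 * degree * (n + t * trunc_log 2 n)).
  move=> x f fb; split; last exact: prog_decides.
  apply: leq_trans (prog_traffic tn sigmaP rhoP x fb) _; exact: program_traffic_bound.
split=> // x f hf; have [T hT ha] := h2 x f hf; exists T => //; apply: leq_trans hT _.
exact: program_size_bound.
Qed.

Theorem theorem12 :
  exists (A : forall n t : nat, protocol n) (C : nat),
  forall n t : nat, 5 * t < n ->
  [/\ solves_consensus (A n t) t,
      runs_within (A n t) t (C * (t + trunc_log 2 n))
    & sends_within (A n t) t (C * (n + t * trunc_log 2 n))].
Proof.
(* The expanders are only known to exist, so choice turns the protocols for the single [n] and [t]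
   into one algorithm. *)
exists (fun n t =>
  proj1_sig (constructive_indefinite_description _ (consensus_protocol_exists n t))).
exists (100 * degree) => n t.
exact: proj2_sig (constructive_indefinite_description _ (consensus_protocol_exists n t)).
Qed.
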